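(* Let $A$ be a commutative noetherian ring and $n$ a non-negative integer. (1) If $\Lambda$ is a noether $A$-algebra of positive rank (as an $A$-module) and $\mathsf{ca}^{n}(\Lambda)$ contains a non-zerodivisor (of the center $\Lambda^{c}$), then $A$ is reduced, and $\mathsf{ca}^{n}(A)$ contains a non-zerodivisor (of $A$). (2) If $\mathsf{ca}^{n}(A)$ contains a non-zerodivisor, then for any finitely generated torsion-free $A$-module $M$ of positive rank, $\mathsf{ca}^{n}(\mathrm{End}_{A}(M))$ contains a non-zerodivisor (of the center of $\mathrm{End}_{A}(M)$).
   Context: A noether $A$-algebra is an $A$-algebra $\Lambda$ (so $A$ acts through the center $\Lambda^{c}$ of $\Lambda$) that is finitely generated as an $A$-module. Modules are right modules; $\mathrm{mod}\,\Lambda$ is the category of finitely generated $\Lambda$-modules. For $n\ge 0$, $\mathsf{ca}^{n}(\Lambda)$ is the ideal of all $a\in\Lambda^{c}$ with $a\,\mathrm{Ext}^{i}_{\Lambda}(M,N)=0$ for all $M,N\in\mathrm{mod}\,\Lambda$ and all $i\ge n$. With $Q$ the total ring of fractions of $A$, a finitely generated $A$-module $M$ has rank $r$ if $Q\otimes_{A}M$ is a free $Q$-module of rank $r$; ''of positive rank'' means it has a rank $r\ge 1$. $M$ is torsion-free if every non-zerodivisor of $A$ is a non-zerodivisor on $M$. *)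

(* Defs.v *)
From HB Require Import structures.
From mathcomp Require Import all_boot all_algebra.
From mathcomp Require Import ring boolp classical_sets.

Set Implicit Arguments.
Unset Strict Implicit.
Unset Printing Implicit Defensive.

Import GRing.Theory.

Local Open Scope ring_scope.
Local Open Scope quotient_scope.

(******************************************************************************)
(* Rings are not assumed nontrivial ([pzRingType]); [lmodType R] is the type  *)
(* of left [R]-modules, so right modules over a ring [L] are left modules     *)
(* over the converse ring [L^c].                                              *)
(******************************************************************************)

(** * Commutative rings and finiteness conditions *)

Definition nonzerodivisor (A : comPzRingType) (a : A) : Prop :=
  forall b, a * b = 0 -> b = 0.

Definition reduced (A : comPzRingType) : Prop :=
  forall (a : A) (k : nat), a ^+ k = 0 -> a = 0.

Definition is_ideal (A : comPzRingType) (I : set A) : Prop :=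
  [/\ I 0, forall x y, I x -> I y -> I (x + y)
    & forall a x, I x -> I (a * x)].

Definition noetherian (A : comPzRingType) : Prop :=
  forall I : set A, is_ideal I ->
    exists (r : nat) (e : 'I_r -> A),
      I = [set x | exists c : 'I_r -> A, x = \sum_i c i * e i]%classic.

Definition finitely_generated (R : pzRingType) (M : lmodType R) : Prop :=
  exists (r : nat) (e : 'I_r -> M),
    forall m, exists c : 'I_r -> R, m = \sum_i c i *: e i.

Definition torsion_free (A : comPzRingType) (M : lmodType A) : Prop :=
  forall a : A, nonzerodivisor a -> forall m : M, a *: m = 0 -> m = 0.

(** * Total ring of fractions *)

Section TotalFractions.
Variable A : comPzRingType.

Lemma nonzerodivisor1 : nonzerodivisor (1 : A).
Proof. by move=> b; rewrite mul1r. Qed.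

Lemma nonzerodivisorM (a b : A) :
  nonzerodivisor a -> nonzerodivisor b -> nonzerodivisor (a * b).
Proof. by move=> ha hb c; rewrite -mulrA => /ha /hb. Qed.

Record tfraction := TFraction {
  tnum : A;
  tden : A;
  tdenP : nonzerodivisor tden }.

HB.instance Definition _ := gen_eqMixin tfraction.
HB.instance Definition _ := gen_choiceMixin tfraction.

Definition tequiv (x y : tfraction) : bool :=
  tnum x * tden y == tnum y * tden x.

Lemma tequiv_class : equiv_class_of tequiv.
Proof.
split=> [x|x y|y x z]; rewrite /tequiv.
- exact: eqxx.
- exact: eq_sym.
- move=> /eqP xy /eqP yz; apply/eqP/subr0_eq; apply: (@tdenP y).
transitivity ((tnum x * tden y) * tden z - (tnum z * tden y) * tden x).
  by ring.
by rewrite xy -yz; ring.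
Qed.

Canonical tequiv_equiv := EquivRelPack tequiv_class.
Canonical tequiv_encModRel := defaultEncModRel tequiv.

Definition totfrac := {eq_quot tequiv}.
HB.instance Definition _ : EqQuotient tfraction tequiv totfrac :=
  EqQuotient.on totfrac.
HB.instance Definition _ := Choice.on totfrac.

Definition tfrac0 := TFraction 0 nonzerodivisor1.
Definition tfrac1 := TFraction 1 nonzerodivisor1.
Definition tfrac_opp (x : tfraction) := TFraction (- tnum x) (@tdenP x).
Definition tfrac_add (x y : tfraction) :=
  TFraction (tnum x * tden y + tnum y * tden x)
    (nonzerodivisorM (@tdenP x) (@tdenP y)).
Definition tfrac_mul (x y : tfraction) :=
  TFraction (tnum x * tnum y)
    (nonzerodivisorM (@tdenP x) (@tdenP y)).

Definition totfrac_zero : totfrac := \pi_totfrac tfrac0.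
Definition totfrac_one : totfrac := \pi_totfrac tfrac1.
Definition totfrac_opp (x : totfrac) : totfrac := \pi_totfrac (tfrac_opp (repr x)).
Definition totfrac_add (x y : totfrac) : totfrac :=
  \pi_totfrac (tfrac_add (repr x) (repr y)).
Definition totfrac_mul (x y : totfrac) : totfrac :=
  \pi_totfrac (tfrac_mul (repr x) (repr y)).

Lemma totfracP (x y : tfraction) :
  tnum x * tden y = tnum y * tden x <-> \pi_totfrac x = \pi_totfrac y.
Proof.
by split=> [/eqP h|/eqmodP/eqP//]; apply/eqmodP.
Qed.

Let repr_pi (x : tfraction) :
  tnum (repr (\pi_totfrac x)) * tden x = tnum x * tden (repr (\pi_totfrac x)).
Proof. by apply/totfracP; rewrite reprK. Qed.

Lemma totfrac_oppE x : totfrac_opp (\pi_totfrac x) = \pi_totfrac (tfrac_opp x).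
Proof. by apply/totfracP => /=; rewrite !mulNr repr_pi. Qed.

Lemma totfrac_addE x y :
  totfrac_add (\pi_totfrac x) (\pi_totfrac y) = \pi_totfrac (tfrac_add x y).
Proof.
apply/totfracP => /=.
move: (repr_pi x) (repr_pi y).
move: (repr (\pi_totfrac x)) (repr (\pi_totfrac y)) => x' y' hx hy.
transitivity (tnum x' * tden x * (tden y' * tden y)
              + tnum y' * tden y * (tden x' * tden x)); first by ring.
by rewrite hx hy; ring.
Qed.

Lemma totfrac_mulE x y :
  totfrac_mul (\pi_totfrac x) (\pi_totfrac y) = \pi_totfrac (tfrac_mul x y).
Proof. by apply/totfracP => /=; rewrite mulrACA !repr_pi mulrACA. Qed.

Lemma totfrac_ind (P : totfrac -> Prop) :
  (forall x, P (\pi_totfrac x)) -> forall x, P x.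
Proof. by move=> h x; rewrite -[x]reprK. Qed.

Lemma totfrac_addA : associative totfrac_add.
Proof.
elim/totfrac_ind=> x; elim/totfrac_ind=> y; elim/totfrac_ind=> z.
by rewrite !totfrac_addE; apply/totfracP => /=; ring.
Qed.

Lemma totfrac_addC : commutative totfrac_add.
Proof.
elim/totfrac_ind=> x; elim/totfrac_ind=> y.
by rewrite !totfrac_addE; apply/totfracP => /=; ring.
Qed.

Lemma totfrac_add0 : left_id totfrac_zero totfrac_add.
Proof.
elim/totfrac_ind=> x.
by rewrite totfrac_addE; apply/totfracP => /=; ring.
Qed.

Lemma totfrac_addN : left_inverse totfrac_zero totfrac_opp totfrac_add.
Proof.
elim/totfrac_ind=> x.
by rewrite totfrac_oppE totfrac_addE; apply/totfracP => /=; ring.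
Qed.

Lemma totfrac_mulA : associative totfrac_mul.
Proof.
elim/totfrac_ind=> x; elim/totfrac_ind=> y; elim/totfrac_ind=> z.
by rewrite !totfrac_mulE; apply/totfracP => /=; ring.
Qed.

Lemma totfrac_mulC : commutative totfrac_mul.
Proof.
elim/totfrac_ind=> x; elim/totfrac_ind=> y.
by rewrite !totfrac_mulE; apply/totfracP => /=; ring.
Qed.

Lemma totfrac_mul1 : left_id totfrac_one totfrac_mul.
Proof.
elim/totfrac_ind=> x.
by rewrite totfrac_mulE; apply/totfracP => /=; ring.
Qed.

Lemma totfrac_mulD : left_distributive totfrac_mul totfrac_add.
Proof.
elim/totfrac_ind=> x; elim/totfrac_ind=> y; elim/totfrac_ind=> z.
rewrite !(totfrac_addE, totfrac_mulE).
by apply/totfracP => /=; ring.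
Qed.

HB.instance Definition _ := GRing.isZmodule.Build totfrac
  totfrac_addA totfrac_addC totfrac_add0 totfrac_addN.
HB.instance Definition _ := GRing.Zmodule_isComPzRing.Build totfrac
  totfrac_mulA totfrac_mulC totfrac_mul1 totfrac_mulD.

Definition to_totfrac (a : A) : totfrac :=
  \pi_totfrac (TFraction a nonzerodivisor1).

Lemma to_totfrac_is_zmod_morphism : zmod_morphism to_totfrac.
Proof.
move=> x y; rewrite -[RHS]/(totfrac_add (to_totfrac x) (totfrac_opp (to_totfrac y))).
rewrite totfrac_oppE totfrac_addE.
by apply/totfracP => /=; ring.
Qed.

Lemma to_totfrac_is_monoid_morphism : monoid_morphism to_totfrac.
Proof.
split=> // x y; rewrite [RHS]totfrac_mulE.
by apply/totfracP => /=; ring.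
Qed.

HB.instance Definition _ := GRing.isZmodMorphism.Build A totfrac to_totfrac
  to_totfrac_is_zmod_morphism.
HB.instance Definition _ := GRing.isMonoidMorphism.Build A totfrac to_totfrac
  to_totfrac_is_monoid_morphism.

End TotalFractions.

(** * Extension of scalars *)

Section BaseChange.
Variables (A B : comPzRingType) (phi : {rmorphism A -> B}) (M : lmodType A).

(* The sequence [:: (b1, m1); ...; (bk, mk)] stands for the formal sum        *)
(* b1 (x) m1 + ... + bk (x) mk, and [tensor_rel] is the congruence of the     *)
(* free commutative monoid on B * M generated by the relations of B (x)_A M;  *)
(* since b (x) m + (- b) (x) m ~ 0, the quotient is already a group.          *)
Inductive tensor_rel : seq (B * M) -> seq (B * M) -> Prop :=
| tensor_refl s : tensor_rel s s
| tensor_sym s t : tensor_rel s t -> tensor_rel t s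
| tensor_trans s t u : tensor_rel s t -> tensor_rel t u -> tensor_rel s u
| tensor_cat s s' t t' :
    tensor_rel s s' -> tensor_rel t t' -> tensor_rel (s ++ t) (s' ++ t')
| tensor_comm s t : tensor_rel (s ++ t) (t ++ s)
| tensor_zero m : tensor_rel [:: (0, m)] [::]
| tensor_addl b c m : tensor_rel [:: (b + c, m)] [:: (b, m); (c, m)]
| tensor_addr b m m' : tensor_rel [:: (b, m + m')] [:: (b, m); (b, m')]
| tensor_bal b a m : tensor_rel [:: (b * phi a, m)] [:: (b, a *: m)].

Definition tensor_equiv (s t : seq (B * M)) : bool := `[< tensor_rel s t >].

Lemma tensor_equiv_class : equiv_class_of tensor_equiv.
Proof.
split=> [s|s t|t s u].
- exact/asboolP/tensor_refl.
- by apply/asboolP/asboolP; apply: tensor_sym.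
- by move=> /asboolP st /asboolP tu; apply/asboolP/tensor_trans/tu.
Qed.

Canonical tensor_equiv_equiv := EquivRelPack tensor_equiv_class.
Canonical tensor_equiv_encModRel := defaultEncModRel tensor_equiv.

Definition base_change := {eq_quot tensor_equiv}.
HB.instance Definition _ :
    EqQuotient (seq (B * M)) tensor_equiv base_change :=
  EqQuotient.on base_change.
HB.instance Definition _ := Choice.on base_change.

Definition fsum_scale (c : B) (s : seq (B * M)) : seq (B * M) :=
  [seq (c * x.1, x.2) | x <- s].

Definition tensor_zeroq : base_change := \pi_base_change [::].
Definition tensor_addq (x y : base_change) : base_change :=
  \pi_base_change (repr x ++ repr y).
Definition tensor_scaleq (c : B) (x : base_change) : base_change :=
  \pi_base_change (fsum_scale c (repr x)).
Definition tensor_oppq : base_change -> base_change := tensor_scaleq (- 1).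

Lemma base_changeP (s t : seq (B * M)) :
  tensor_rel s t <-> \pi_base_change s = \pi_base_change t.
Proof.
by split=> [h|/eqmodP/asboolP//]; apply/eqmodP/asboolP.
Qed.

Lemma repr_base_change s : tensor_rel (repr (\pi_base_change s)) s.
Proof. by apply/base_changeP; rewrite reprK. Qed.

Lemma fsum_scale_rel c s t :
  tensor_rel s t -> tensor_rel (fsum_scale c s) (fsum_scale c t).
Proof.
elim=> {s t} /=.
- by move=> s; apply: tensor_refl.
- by move=> s t _; apply: tensor_sym.
- by move=> s t u _ st _; apply: tensor_trans.
- by move=> s s' t t' _ hs _ ht; rewrite /fsum_scale !map_cat; apply: tensor_cat.
- by move=> s t; rewrite /fsum_scale !map_cat; apply: tensor_comm.
- by move=> m; rewrite mulr0; apply: tensor_zero.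
- by move=> b b' m; rewrite mulrDr; apply: tensor_addl.
- by move=> b m m'; apply: tensor_addr.
- by move=> b a m; rewrite mulrA; apply: tensor_bal.
Qed.

Lemma tensor_addqE s t :
  tensor_addq (\pi_base_change s) (\pi_base_change t) = \pi_base_change (s ++ t).
Proof. by apply/base_changeP/tensor_cat; apply: repr_base_change. Qed.

Lemma tensor_scaleqE c s :
  tensor_scaleq c (\pi_base_change s) = \pi_base_change (fsum_scale c s).
Proof. by apply/base_changeP/fsum_scale_rel/repr_base_change. Qed.

Lemma base_change_ind (P : base_change -> Prop) :
  (forall s, P (\pi_base_change s)) -> forall x, P x.
Proof. by move=> h x; rewrite -[x]reprK. Qed.

Lemma tensor_addqA : associative tensor_addq.
Proof.
elim/base_change_ind=> s; elim/base_change_ind=> t; elim/base_change_ind=> u.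
by rewrite !tensor_addqE catA.
Qed.

Lemma tensor_addqC : commutative tensor_addq.
Proof.
elim/base_change_ind=> s; elim/base_change_ind=> t.
by rewrite !tensor_addqE; apply/base_changeP/tensor_comm.
Qed.

Lemma tensor_add0q : left_id tensor_zeroq tensor_addq.
Proof. by elim/base_change_ind=> s; rewrite tensor_addqE. Qed.

Lemma fsum_scaleDl c d s :
  tensor_rel (fsum_scale (c + d) s) (fsum_scale c s ++ fsum_scale d s).
Proof.
elim: s => [|[b m] s IHs] /=; first exact: tensor_refl.
rewrite mulrDl.
apply: (tensor_trans (tensor_cat (tensor_addl (c * b) (d * b) m) IHs)).
apply: (@tensor_cat [:: _] [:: _]); first exact: tensor_refl.
rewrite -[X in tensor_rel X]/([:: (d * b, m)] ++ (fsum_scale c s ++ fsum_scale d s)).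
rewrite -[X in tensor_rel _ X]/(fsum_scale c s ++ ([:: (d * b, m)] ++ fsum_scale d s)).
rewrite !catA.
by apply: tensor_cat; [apply: tensor_comm | apply: tensor_refl].
Qed.

Lemma fsum_scale0 s : tensor_rel (fsum_scale 0 s) [::].
Proof.
elim: s => [|[b m] s IHs] /=; first exact: tensor_refl.
by rewrite mul0r; apply: (tensor_cat (tensor_zero m) IHs).
Qed.

Lemma tensor_scale1q : left_id 1 tensor_scaleq.
Proof.
elim/base_change_ind=> s; rewrite tensor_scaleqE; congr (\pi_base_change _).
by elim: s => //= -[b m] s IHs; rewrite mul1r IHs.
Qed.

Lemma tensor_scaleqDl x :
  {morph tensor_scaleq^~ x : c d / c + d >-> tensor_addq c d}.
Proof.
elim/base_change_ind: x => s c d.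
by rewrite !tensor_scaleqE tensor_addqE; apply/base_changeP/fsum_scaleDl.
Qed.

Lemma tensor_addNq : left_inverse tensor_zeroq tensor_oppq tensor_addq.
Proof.
move=> x; rewrite -[X in tensor_addq _ X]tensor_scale1q -tensor_scaleqDl addNr.
elim/base_change_ind: x => s; rewrite tensor_scaleqE.
exact/base_changeP/fsum_scale0.
Qed.

HB.instance Definition _ := GRing.isZmodule.Build base_change
  tensor_addqA tensor_addqC tensor_add0q tensor_addNq.

Lemma tensor_scaleqA c d x :
  tensor_scaleq c (tensor_scaleq d x) = tensor_scaleq (c * d) x.
Proof.
elim/base_change_ind: x => s; rewrite !tensor_scaleqE; congr (\pi_base_change _).
by elim: s => //= -[b m] s IHs; rewrite mulrA IHs.
Qed.

Lemma tensor_scaleqDr : right_distributive tensor_scaleq +%R.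
Proof.
move=> c; elim/base_change_ind=> s; elim/base_change_ind=> t.
rewrite [_ + _]tensor_addqE [RHS]/GRing.add /= !tensor_scaleqE tensor_addqE.
by rewrite /fsum_scale map_cat.
Qed.

HB.instance Definition _ := GRing.Zmodule_isLmodule.Build B base_change
  tensor_scaleqA tensor_scale1q tensor_scaleqDr tensor_scaleqDl.

End BaseChange.

Definition has_rank (A : comPzRingType) (M : lmodType A) (r : nat) : Prop :=
  exists f : {linear base_change (@to_totfrac A) M -> 'rV[totfrac A]_r},
    bijective f.

Definition positive_rank (A : comPzRingType) (M : lmodType A) : Prop :=
  exists2 r : nat, (0 < r)%N & has_rank M r.

(** * Homomorphisms and endomorphism rings *)

Section Hom.
Variables (R : pzRingType) (U V : lmodType R).

Definition linhom : Type := {linear U -> V}.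

Lemma homP (f g : linhom) : f =1 g <-> f = g.
Proof.
split=> [|-> //]; case: f g => f [[f1] [f2]] [g [[g1] [g2]]] /= /funext fg.
case: _ / fg g1 g2 => g1 g2.
by rewrite (Prop_irrelevance f1 g1) (Prop_irrelevance f2 g2).
Qed.

HB.instance Definition _ := gen_eqMixin linhom.
HB.instance Definition _ := gen_choiceMixin linhom.

Definition hom_zero : linhom := \0 : {linear U -> V}.
Definition hom_opp (f : linhom) : linhom := (\- f) : {linear U -> V}.
Definition hom_add (f g : linhom) : linhom := (f \+ g) : {linear U -> V}.

Lemma hom_addA : associative hom_add.
Proof. by move=> f g h; apply/homP => x; apply: addrA. Qed.

Lemma hom_addC : commutative hom_add.
Proof. by move=> f g; apply/homP => x; apply: addrC. Qed.

Lemma hom_add0 : left_id hom_zero hom_add.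
Proof. by move=> f; apply/homP => x; apply: add0r. Qed.

Lemma hom_addN : left_inverse hom_zero hom_opp hom_add.
Proof. by move=> f; apply/homP => x; apply: addNr. Qed.

HB.instance Definition _ := GRing.isZmodule.Build linhom
  hom_addA hom_addC hom_add0 hom_addN.

End Hom.

Section Endomorphisms.
Variables (R : pzRingType) (M : lmodType R).

Definition endo : Type := linhom M M.
HB.instance Definition _ := GRing.Zmodule.on endo.

Definition endo_one : endo := idfun : {linear M -> M}.
Definition endo_mul (f g : endo) : endo := (f \o g) : {linear M -> M}.

Lemma endo_mulA : associative endo_mul.
Proof. by move=> f g h; apply/homP. Qed.

Lemma endo_mul1 : left_id endo_one endo_mul.
Proof. by move=> f; apply/homP. Qed.

Lemma endo_mulr1 : right_id endo_one endo_mul.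
Proof. by move=> f; apply/homP. Qed.

Lemma endo_mulDl : left_distributive endo_mul +%R.
Proof. by move=> f g h; apply/homP. Qed.

Lemma endo_mulDr : right_distributive endo_mul +%R.
Proof. by move=> f g h; apply/homP => x; apply: raddfD. Qed.

HB.instance Definition _ := GRing.Zmodule_isPzRing.Build endo
  endo_mulA endo_mul1 endo_mulr1 endo_mulDl endo_mulDr.

End Endomorphisms.

(** * The center of a ring *)

Section Center.
Variable L : pzRingType.

Definition central : {pred L} := fun a => `[< forall x, a * x = x * a >].

Lemma centralP (a : L) : reflect (forall x, a * x = x * a) (a \in central).
Proof. exact: asboolP. Qed.

Lemma central_subring_closed : subring_closed central.
Proof.
split=> [|a b /centralP ca /centralP cb|a b /centralP ca /centralP cb];
  apply/centralP => x.
- by rewrite mul1r mulr1.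
- by rewrite mulrBl mulrBr ca cb.
- by rewrite -mulrA cb !mulrA ca.
Qed.

HB.instance Definition _ :=
  GRing.isSubringClosed.Build L central central_subring_closed.

Record ring_center := Center { center_val :> L; _ : center_val \in central }.

HB.instance Definition _ := [isSub for center_val].
HB.instance Definition _ := [Choice of ring_center by <:].
HB.instance Definition _ :=
  GRing.SubChoice_isSubPzRing.Build L central ring_center central_subring_closed.

Lemma center_mulC : commutative (@GRing.mul ring_center).
Proof. by move=> a b; apply/val_inj; exact: (centralP _ (valP a)). Qed.

HB.instance Definition _ :=
  GRing.PzRing_hasCommutativeMul.Build ring_center center_mulC.

End Center.

(** * Projective resolutions and Ext *)

Definition projective (R : pzRingType) (P : lmodType R) : Prop :=
  forall (U V : lmodType R) (p : {linear U -> V}) (f : {linear P -> V}),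
    (forall v, exists u, p u = v) ->
    exists g : {linear P -> U}, forall x, p (g x) = f x.

Record projective_resolution (R : pzRingType) (M : lmodType R) := {
  res_mod :> nat -> lmodType R;
  res_diff : forall i, {linear res_mod i.+1 -> res_mod i};
  res_aug : {linear res_mod 0%N -> M};
  res_projective : forall i, projective (res_mod i);
  res_aug_surj : forall m, exists x, res_aug x = m;
  res_exact0 : forall x, res_aug x = 0 <-> exists y, res_diff 0 y = x;
  res_exactS : forall i x, res_diff i x = 0 <-> exists y, res_diff i.+1 y = x }.

(* The center of [L] acts on the homomorphisms of right [L]-modules, which    *)
(* makes the Ext groups modules over the center.                              *)

Section CenterAction.
Variables (L : pzRingType) (U V : lmodType L^c).

Definition hom_scale_fun (a : ring_center L) (f : linhom U V) (x : U) : V :=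
  (center_val a : L^c) *: f x.

Lemma hom_scale_linear a f : linear (hom_scale_fun a f).
Proof.
move=> c x y; rewrite /hom_scale_fun linearP scalerDr !scalerA.
by congr (_ *: _ + _); apply/esym/(centralP _ (valP a)).
Qed.

HB.instance Definition _ a f :=
  GRing.isLinear.Build L^c U V *:%R (hom_scale_fun a f) (hom_scale_linear a f).

Definition hom_scale (a : ring_center L) (f : linhom U V) : linhom U V :=
  hom_scale_fun a f : {linear U -> V}.

Lemma hom_scaleA a b f : hom_scale a (hom_scale b f) = hom_scale (a * b) f.
Proof.
apply/homP => x; rewrite /= /hom_scale_fun /= scalerA; congr (_ *: _).
exact/esym/(centralP _ (valP a)).
Qed.

Lemma hom_scale1 : left_id 1 hom_scale.
Proof. by move=> f; apply/homP => x; apply: scale1r. Qed.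

Lemma hom_scaleDr : right_distributive hom_scale +%R.
Proof. by move=> a f g; apply/homP => x; apply: scalerDr. Qed.

Lemma hom_scaleDl f : {morph hom_scale^~ f : a b / a + b}.
Proof. by move=> a b; apply/homP => x; apply: scalerDl. Qed.

HB.instance Definition _ := GRing.Zmodule_isLmodule.Build (ring_center L) (linhom U V)
  hom_scaleA hom_scale1 hom_scaleDr hom_scaleDl.

End CenterAction.

Section Ext.
Variables (L : pzRingType) (M : lmodType L^c) (P : projective_resolution M).
Variables (N : lmodType L^c) (i : nat).

Definition is_cocycle : {pred linhom (P i) N} :=
  fun f => `[< forall x, f (res_diff P i x) = 0 >].

Lemma cocycle_submod_closed : submod_closed is_cocycle.
Proof.
split=> [|a f g /asboolP cf /asboolP cg]; apply/asboolP => x //.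
by rewrite /= /hom_scale_fun cf cg scaler0 addr0.
Qed.

HB.instance Definition _ := GRing.isSubmodClosed.Build (ring_center L) (linhom (P i) N)
  is_cocycle cocycle_submod_closed.

Record cocycle := Cocycle {
  cocycle_val :> linhom (P i) N;
  _ : cocycle_val \in is_cocycle }.

HB.instance Definition _ := [isSub for cocycle_val].
HB.instance Definition _ := [Choice of cocycle by <:].
HB.instance Definition _ := [SubChoice_isSubLmodule of cocycle by <:].

Definition coboundary_spec (j : nat) : linhom (P j) N -> Prop :=
  match j with
  | 0 => fun f => f = 0
  | k.+1 => fun f =>
      exists g : linhom (P k) N, forall x, f x = g (res_diff P k x)
  end.

Definition is_coboundary : {pred cocycle} :=
  fun f => `[< coboundary_spec (cocycle_val f) >].

Lemma coboundary_submod_closed : submod_closed is_coboundary.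
Proof.
rewrite /is_coboundary; split=> [|a f g /asboolP cf /asboolP cg];
  apply/asboolP.
  rewrite -[cocycle_val 0]/(val 0) raddf0.
  by case: (i) => [|k] //=; exists 0.
rewrite -[cocycle_val _]/(val (a *: f + g)) linearP /=.
move: (cocycle_val f) (cocycle_val g) cf cg.
case: (i) => [|k] /= u v; first by move=> -> ->; rewrite scaler0 addr0.
move=> [u' hu] [v' hv]; exists (a *: u' + v') => x.
by rewrite /= /hom_scale_fun hu hv.
Qed.

HB.instance Definition _ := GRing.isSubmodClosed.Build (ring_center L) cocycle
  is_coboundary coboundary_submod_closed.

(* The [i]-th cohomology of Hom(P, N), that is, Ext^i(M, N).                  *)
Definition Ext := Quotient.quot is_coboundary.

HB.instance Definition _ := GRing.Zmodule.on Ext.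

Definition Ext_scale (a : ring_center L) (x : Ext) : Ext := \pi_Ext (a *: repr x).

Lemma Ext_scaleE a f : Ext_scale a (\pi_Ext f) = \pi_Ext (a *: f).
Proof.
apply/eqP; rewrite -Quotient.idealrBE -scalerBr rpredZ //.
by rewrite Quotient.idealrBE reprK.
Qed.

Lemma Ext_ind (T : Ext -> Prop) :
  (forall f, T (\pi_Ext f)) -> forall x, T x.
Proof. by move=> h x; rewrite -[x]reprK. Qed.

Lemma Ext_addE f g : \pi_Ext f + \pi_Ext g = \pi_Ext (f + g).
Proof. exact/esym/Quotient.pi_add. Qed.

Lemma Ext_eq0 f : \pi_Ext f = 0 :> Ext <-> coboundary_spec (cocycle_val f).
Proof.
have -> : 0 = \pi_Ext 0 :> Ext by apply/esym/pi_zeror.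
split=> [/eqP|h]; first by rewrite -Quotient.idealrBE subr0 => /asboolP.
by apply/eqP; rewrite -Quotient.idealrBE subr0; apply/asboolP.
Qed.

Lemma Ext_scaleA a b x : Ext_scale a (Ext_scale b x) = Ext_scale (a * b) x.
Proof. by elim/Ext_ind: x => f; rewrite !Ext_scaleE scalerA. Qed.

Lemma Ext_scale1 : left_id 1 Ext_scale.
Proof. by elim/Ext_ind=> f; rewrite Ext_scaleE scale1r. Qed.

Lemma Ext_scaleDr : right_distributive Ext_scale +%R.
Proof.
move=> a; elim/Ext_ind=> f; elim/Ext_ind=> g.
by rewrite Ext_addE !Ext_scaleE Ext_addE scalerDr.
Qed.

Lemma Ext_scaleDl x : {morph Ext_scale^~ x : a b / a + b}.
Proof.
elim/Ext_ind: x => f a b.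
by rewrite !Ext_scaleE Ext_addE scalerDl.
Qed.

HB.instance Definition _ := GRing.Zmodule_isLmodule.Build (ring_center L) Ext
  Ext_scaleA Ext_scale1 Ext_scaleDr Ext_scaleDl.

End Ext.

(* Ext^i(M, N) does not depend on the resolution of M up to an isomorphism of *)
(* modules over the center, so all resolutions give the same condition.       *)
Definition ca (n : nat) (L : pzRingType) : set (ring_center L) :=
  [set a | forall M N : lmodType L^c,
     finitely_generated M -> finitely_generated N ->
     forall (P : projective_resolution M) (i : nat), (n <= i)%N ->
     forall x : Ext P N i, a *: x = 0]%classic.

(* Main.v *)
Require Import Defs.
From HB Require Import structures.
From mathcomp Require Import all_boot all_algebra.
From mathcomp Require Import ring boolp classical_sets.

Set Implicit Arguments.
Unset Strict Implicit.
Unset Printing Implicit Defensive.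

(* In a projective resolution of M, the scalar c annihilates Ext^{n+1}(M, -)  *)
(* as soon as c d = d r d for a linear map r, where d is the differential in  *)
(* degree n. Such an r can be transported along comparison maps of            *)
(* resolutions, even when these exist only up to a non-zerodivisor t, at the  *)
(* price of multiplying c by a power of t that depends only on n. By the rank *)
(* hypotheses, Lambda and End(M) have bases up to a non-zerodivisor, so their *)
(* projective modules are projective over A up to t.                          *)
(*                                                                            *)
(* (2) An A-resolution of an E-module X, for E = End(M), is compared with an  *)
(* E-resolution of X; the resulting r is only A-linear, but E is separable    *)
(* over A up to a non-zerodivisor (it is generically a matrix ring), so r can *)
(* be averaged.                                                               *)
(*                                                                            *)
(* (1) An A-module X is a retract up to t of the Lambda-module Hom_A(Lambda,  *)
(* X), so the element c of ca(Lambda) acts on A-resolutions as well. If A     *)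
(* were not reduced, there would be s <> 0 with s^2 = 0 and p = ann(s) prime. *)
(* High syzygies V over A satisfy: s v = 0 implies v in pV, locally at p.     *)
(* By Nakayama's lemma this property descends from a syzygy to the module, so *)
(* it holds for sA, which is absurd. Once A is reduced, integrality of c over *)
(* A gives a non-zerodivisor of A in c Lambda^c.                              *)

Import GRing.Theory.

Local Open Scope ring_scope.
Local Open Scope quotient_scope.

(** * Linear maps, submodules and restriction of scalars *)

(** The condition [killed P n c] turns annihilation of Ext^{n+1} into the existence of one map
    inside a resolution; [ca_killed] and [ca_intro] translate between it and [ca], while ca^0 is
    zero by [ca0_eq0]. By [rank_approx_basis], a finitely generated module with a rank has a basis
    and a dual family up to a non-zerodivisor. Hence Lambda and End(M), and with them the
    restrictions of their finitely generated projective modules, are projective over A up to such a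
    scalar. Under this weak projectivity [comparison] still builds comparison maps and homotopies,
    and [killed_retract] transports annihilation along them.

    Both halves rest on the single lemma [ca_transfer], for two A-algebras L and L'. Over A, an
    L'-module X is a retract, up to t, of the L-module Hom_A(L, X): x goes to l |-> g(l) x, and
    evaluation at m comes back, with g(m) = t. The A-linear map found for X is made L'-linear by
    [killed_separable]. Half (1) uses L = Lambda and L' = A; half (2) uses L = A and L' = End(M),
    where the rank-one maps m_i f_j act as matrix units.

    Half (1) also needs [reduced_base] and [central_nonzerodivisor]. For the former, a nonzero y
    with y^2 = 0 has a multiple s with s^2 = 0 and prime annihilator p. Syzygies of a high enough
    order over Lambda are [good] at p ([good_coker_restr]); this passes to retracts
    ([good_coker_retract]) and down from syzygies ([good_quotient]), hence to sA. But s kills the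
    generator of sA while p(sA) = 0. For the latter, c is integral over A, and reducedness produces
    a non-zerodivisor of A inside c Lambda^c, to which [ca_transfer] applies. *)

Definition mklin (R : pzRingType) (U V : lmodType R) (f : U -> V)
    (lf : linear f) : {linear U -> V} :=
  HB.pack f (GRing.isLinear.Build R U V *:%R f lf).

Section Submodules.
Variables (R : pzRingType) (X : lmodType R).

Record submodule := Submodule {
  smem :> X -> Prop;
  smem0 : smem 0;
  smemD : forall a x y, smem x -> smem y -> smem (a *: x + y) }.

Variable S : submodule.

Lemma submodule_scale a x : S x -> S (a *: x).
Proof. by move=> h; rewrite -[_ *: _]addr0; apply: smemD => //; apply: smem0. Qed.

Lemma submodule_add x y : S x -> S y -> S (x + y).
Proof. by move=> hx hy; rewrite -[x]scale1r; apply: smemD. Qed.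

Lemma submodule_sub x y : S x -> S y -> S (x - y).
Proof. by move=> hx hy; rewrite addrC -scaleN1r; apply: smemD. Qed.

Definition smem_pred : {pred X} := fun x => `[< S x >].

Lemma smem_pred_closed : submod_closed smem_pred.
Proof.
split=> [|a x y /asboolP hx /asboolP hy]; apply/asboolP.
  exact: smem0.
exact: smemD.
Qed.

HB.instance Definition _ :=
  GRing.isSubmodClosed.Build R X smem_pred smem_pred_closed.

Record subm := Subm { subm_val :> X; _ : subm_val \in smem_pred }.

HB.instance Definition _ := [isSub for subm_val].
HB.instance Definition _ := [Choice of subm by <:].
HB.instance Definition _ := [SubChoice_isSubLmodule of subm by <:].

Lemma submP (x : subm) : S (val x).
Proof. exact/asboolP/(valP x). Qed.

Definition subm_in (x : X) (h : S x) : subm := Subm (introT (asboolP _) h).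

Lemma subm_val_linear : linear (fun x : subm => val x).
Proof. by []. Qed.

Definition subm_lin : {linear subm -> X} := mklin subm_val_linear.

End Submodules.

Section ImageKernel.
Variables (R : pzRingType) (U V : lmodType R) (f : {linear U -> V}).

Lemma ker_sub_closed a x y : f x = 0 -> f y = 0 -> f (a *: x + y) = 0.
Proof. by move=> hx hy; rewrite linearP hx hy scaler0 addr0. Qed.

Definition ker_sub : submodule U :=
  @Submodule _ _ (fun x => f x = 0) (raddf0 f) ker_sub_closed.

Lemma img_sub_closed a x y :
  (exists u, f u = x) -> (exists v, f v = y) -> exists w, f w = a *: x + y.
Proof. by move=> [u <-] [v <-]; exists (a *: u + v); rewrite linearP. Qed.

Definition img_sub : submodule V :=
  @Submodule _ _ (fun y => exists x, f x = y) (ex_intro _ 0 (raddf0 f))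
    img_sub_closed.

End ImageKernel.

Section Corestriction.
Variables (R : pzRingType) (U V : lmodType R) (S : submodule V).
Variables (f : {linear U -> V}) (fS : forall x, S (f x)).

Lemma corestrict_linear : linear (fun x => subm_in (fS x)).
Proof. by move=> a x y; apply/val_inj; rewrite /= linearP. Qed.

Definition corestrict : {linear U -> subm S} := mklin corestrict_linear.

End Corestriction.

(** The morphism is a phantom argument: it selects the [A]-module structure that is put on the type
    [X] below. *)
Definition restr (A : comPzRingType) (L : pzRingType)
  (_ : {rmorphism A -> L}) (X : lmodType L^c) : Type := X.

Section RestrictScalars.
Variables (A : comPzRingType) (L : pzRingType) (rho : {rmorphism A -> L}).
Variable X : lmodType L^c.

Local Notation restr := (restr rho X).
HB.instance Definition _ := GRing.Zmodule.copy restr X.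

Definition restr_scale (a : A) (x : restr) : restr := (rho a : L^c) *: (x : X).

Lemma restr_scaleA a b x : restr_scale a (restr_scale b x) = restr_scale (a * b) x.
Proof. by rewrite /restr_scale scalerA mulrC rmorphM. Qed.

Lemma restr_scale1 : left_id 1 restr_scale.
Proof. by move=> x; rewrite /restr_scale rmorph1 (scale1r (x : X)). Qed.

Lemma restr_scaleDr : right_distributive restr_scale +%R.
Proof. by move=> a x y; apply: (scalerDr _ (x : X)). Qed.

Lemma restr_scaleDl x : {morph restr_scale^~ x : a b / a + b}.
Proof. by move=> a b; rewrite /restr_scale rmorphD; apply: (scalerDl (x : X)). Qed.

HB.instance Definition _ := GRing.Zmodule_isLmodule.Build A restr
  restr_scaleA restr_scale1 restr_scaleDr restr_scaleDl.

End RestrictScalars.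

Lemma restr_lin_subproof (A : comPzRingType) (L : pzRingType)
    (rho : {rmorphism A -> L}) (X Y : lmodType L^c) (f : {linear X -> Y}) :
  linear (f : restr rho X -> restr rho Y).
Proof.
by move=> a x y; apply: (linearP f (rho a : L^c) (x : X) (y : X)).
Qed.

Definition restr_lin (A : comPzRingType) (L : pzRingType)
    (rho : {rmorphism A -> L}) (X Y : lmodType L^c) (f : {linear X -> Y}) :
    {linear restr rho X -> restr rho Y} :=
  mklin (restr_lin_subproof (rho := rho) f).

(** * Finite generation *)

Section Span.
Variables (R : pzRingType) (V : lmodType R).

Fixpoint lspan (s : seq V) (x : V) : Prop :=
  if s is v :: s' then exists a, lspan s' (x - a *: v) else x = 0.

Lemma lspan0 s : lspan s 0.
Proof. by elim: s => //= v s IHs; exists 0; rewrite scale0r subr0. Qed.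

Lemma lspanP s a x y : lspan s x -> lspan s y -> lspan s (a *: x + y).
Proof.
elim: s a x y => /= [|v s IHs] a x y; first by move=> -> ->; rewrite scaler0 addr0.
move=> [b hb] [c hc]; exists (a * b + c).
suff -> : a *: x + y - (a * b + c) *: v = a *: (x - b *: v) + (y - c *: v).
  exact: IHs.
by rewrite scalerBr scalerDl scalerA opprD addrACA.
Qed.

Definition lspan_sub s := Submodule (lspan0 s) (@lspanP s).

Lemma smem_lspan (S : submodule V) s x :
  (forall v, v \in s -> S v) -> lspan s x -> S x.
Proof.
elim: s x => /= [|v s IHs] x hS; first by move=> ->; apply: smem0.
move=> [a /IHs hx]; rewrite -(subrK (a *: v) x) addrC.
by apply: smemD;
  [apply: hS; rewrite mem_head | apply: hx => w hw; apply: hS; rewrite inE hw orbT].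
Qed.

Lemma mem_lspan s v : v \in s -> lspan s v.
Proof.
elim: s => //= w s IHs; rewrite inE => /orP[/eqP -> | /IHs h].
  by exists 1; rewrite scale1r subrr; apply: lspan0.
by exists 0; rewrite scale0r subr0.
Qed.

Lemma smem_sum (S : submodule V) (I : Type) (r : seq I) (P : pred I) (c : I -> R)
    (e : I -> V) :
  (forall i, S (e i)) -> S (\sum_(i <- r | P i) c i *: e i).
Proof.
move=> h; apply: (big_rec (fun x => S x)); first exact: smem0.
by move=> i x _ hx; apply: smemD.
Qed.

Lemma smem_bigsum (S : submodule V) (I : Type) (r : seq I) (P : pred I)
    (f : I -> V) : (forall i, S (f i)) -> S (\sum_(i <- r | P i) f i).
Proof.
move=> h; apply: (big_rec (fun x => S x)); first exact: smem0.
by move=> i x _ hx; rewrite -[f i]scale1r; apply: smemD.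
Qed.

Lemma lspan_sum s x :
  lspan s x -> exists c : 'I_(size s) -> R, x = \sum_i c i *: s`_i.
Proof.
elim: s x => /= [|v s IHs] x; first by move=> ->; exists (fun=> 0);
  rewrite big_ord0.
move=> [a /IHs [c hc]].
exists (fun i => oapp c a (unlift ord0 i)).
rewrite big_ord_recl unlift_none /= -(subrK (a *: v) x) hc addrC; congr (_ + _).
by apply: eq_bigr => i _; rewrite liftK.
Qed.

Lemma fg_lspan : finitely_generated V <-> exists s, forall x, lspan s x.
Proof.
split=> [[r [e he]]|[s hs]].
  exists [seq e i | i <- enum 'I_r] => x; have [c ->] := he x.
  apply: (smem_sum (S := lspan_sub _)) => i /=.
  by apply/mem_lspan/map_f; rewrite mem_enum.
exists (size s), (fun i : 'I_(size s) => s`_i) => x.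
by have [c hc] := lspan_sum (hs x); exists c.
Qed.

End Span.

Lemma fg_surj (R : pzRingType) (U V : lmodType R) (f : {linear U -> V}) :
  (forall y, exists x, f x = y) -> finitely_generated U -> finitely_generated V.
Proof.
move=> hf [r [e he]]; exists r, (fun i => f (e i)) => y.
have [x <-] := hf y; have [c ->] := he x; exists c.
by rewrite linear_sum; apply: eq_bigr => i _; rewrite linearZ.
Qed.

Section Noetherian.
Variable A : comPzRingType.
Hypothesis noethA : noetherian A.

(** Induction on the generators. The possible coefficients of [v] in elements of [S] form a finitely
    generated ideal [I]. Subtracting a combination of lifts [x i] of its generators brings an
    element of [S] into the span of the remaining generators, where induction applies. *)
Lemma noetherian_submodule (V : lmodType A) (s : seq V) (S : submodule V) :
  (forall x, S x -> lspan s x) ->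
  exists t, (forall v, v \in t -> S v) /\ (forall x, S x -> lspan t x).
Proof.
elim: s S => /= [|v s IHs] S hS; first by exists [::].
pose I := [set a : A | exists x, S x /\ lspan s (x - a *: v)]%classic.
have idI : is_ideal I.
  split.
  - by exists 0; split; [apply: smem0 | rewrite scale0r subr0; apply: lspan0].
  - move=> a b [x [Sx hx]] [y [Sy hy]]; exists (1 *: x + y); split;
    first exact: smemD.
    suff -> : 1 *: x + y - (a + b) *: v = 1 *: (x - a *: v) + (y - b *: v).
      exact: lspanP.
    by rewrite !scale1r scalerDl opprD addrACA.
  - move=> b a [x [Sx hx]]; exists (b *: x + 0).
    split; first by apply: smemD => //; apply: smem0.
    suff -> : b *: x + 0 - (b * a) *: v = b *: (x - a *: v) + 0.
      by apply: lspanP => //; apply: lspan0.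
    by rewrite !addr0 scalerBr scalerA.
have [r [e eI]] := noethA idI.
have memI i : exists x, S x /\ lspan s (x - e i *: v).
  suff: I (e i) by [].
  rewrite eI; exists (fun j => (j == i)%:R).
  rewrite (bigD1 i) //= eqxx mul1r big1 ?addr0 // => j /negPf ->.
  by rewrite mul0r.
have /choice [x hx] := memI.
have Sx i : S (x i) by have [] := hx i.
pose S' := @Submodule _ _ (fun y => S y /\ lspan s y)
  (conj (smem0 S) (lspan0 s))
  (fun a x y hx hy => conj (smemD a (proj1 hx) (proj1 hy)) (lspanP a (proj2 hx) (proj2 hy))).
have [t [tS ht]] := IHs S' (fun x => @proj2 _ _).
exists ([seq x i | i <- enum 'I_r] ++ t); split.
  move=> w; rewrite mem_cat => /orP[/mapP[i _ ->] //|/tS[]//].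
move=> y Sy; have [a hya] := hS y Sy.
have : I a by exists y.
rewrite eI => -[c ac].
pose z := \sum_i c i *: x i.
rewrite -(subrK z y) -[y - z]scale1r.
set T := [seq _ | _ <- _]; apply: (smemD (s := lspan_sub (T ++ t))).
  apply: (smem_lspan (S := lspan_sub (T ++ t)) (s := t)).
    by move=> w hw; apply: mem_lspan; rewrite mem_cat hw orbT.
  apply: ht; split.
    rewrite addrC -scaleN1r; apply: smemD => //; exact: smem_sum.
  have -> : y - z = (-1) *: (\sum_i c i *: (x i - e i *: v)) + (y - a *: v).
    under eq_bigr => i _ do rewrite scalerBr scalerA.
    by rewrite sumrB -scaler_suml -ac scaleN1r opprB [RHS]addrC addrA subrK.
  apply: lspanP => //; apply: (smem_sum (S := lspan_sub s)) => i /=.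
  by have [] := hx i.
apply: (smem_sum (S := lspan_sub _)) => i /=.
by apply: mem_lspan; rewrite mem_cat map_f // mem_enum.
Qed.

Lemma fg_inj (U V : lmodType A) (f : {linear U -> V}) :
  injective f -> finitely_generated V -> finitely_generated U.
Proof.
move=> injf /fg_lspan [s hs]; apply/fg_lspan.
have [t [tS ht]] := noetherian_submodule (S := img_sub f) (fun x _ => hs x).
have : exists t', t = [seq f x | x <- t'].
  elim: t tS {ht} => [_|v t IHt hS]; first by exists [::].
  have [x fx] := hS v (mem_head _ _).
  have [w hw|t' ->] := IHt; first by apply: hS; rewrite inE hw orbT.
  by exists (x :: t'); rewrite /= fx.
move=> [t' tt']; exists t' => x.
have : lspan t (f x) by apply: ht; exists x.
rewrite tt'; elim: t' x {t tS ht tt'} => /= [x|v t' IHt x [a]].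
  by rewrite -(raddf0 f) => /injf.
by rewrite -linearZ -linearB => /IHt h; exists a.
Qed.

End Noetherian.
(** * Resolutions *)

Section Resolutions.
Variable R : pzRingType.

Record resolution (M : lmodType R) := Resolution {
  rmod :> nat -> lmodType R;
  rdiff : forall i, {linear rmod i.+1 -> rmod i};
  raug : {linear rmod 0%N -> M};
  raug_surj : forall m, exists x, raug x = m;
  rexact0 : forall x, raug x = 0 <-> exists y, rdiff 0 y = x;
  rexactS : forall i x, rdiff i x = 0 <-> exists y, rdiff i.+1 y = x }.

Arguments raug_surj {M} r m.
Arguments rexact0 {M} r x.
Arguments rexactS {M} r {i} x.

Definition of_projective_resolution (M : lmodType R)
    (P : projective_resolution M) : resolution M :=
  Resolution (@res_aug_surj _ _ P) (@res_exact0 _ _ P) (@res_exactS _ _ P).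

(* Projectivity up to the scalar [t]; for [t = 1] this is projectivity. *)
Definition tproj (t : R) (P : lmodType R) : Prop :=
  forall (U V : lmodType R) (p : {linear U -> V}) (f : {linear P -> V}),
    (forall v, exists u, p u = v) ->
    exists g : {linear P -> U}, forall x, p (g x) = t *: f x.

Lemma tproj1 P : projective P -> tproj 1 P.
Proof.
by move=> h U V p f /(h _ _ _ f)[g hg]; exists g => x; rewrite scale1r.
Qed.

Lemma tproj_lift t (P U V : lmodType R) (d : {linear U -> V})
    (f : {linear P -> V}) :
  tproj t P -> (forall x, exists u, d u = f x) ->
  exists g : {linear P -> U}, forall x, d (g x) = t *: f x.
Proof.
move=> hP hf.
have hd u : img_sub d (d u) by exists u.
have [v|g hg] := hP _ _ (corestrict hd) (corestrict (S := img_sub d) hf).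
  by have [u hu] := submP v; exists u; apply/val_inj.
by exists g => x; have /(congr1 val) := hg x.
Qed.

(* A dual basis up to the scalar [b]; for [b = 1] it is the usual finite dual *)
(* basis of a finitely generated projective module.                           *)
Definition dual_basis (b : R) (M : lmodType R) : Prop :=
  exists k (h : 'I_k -> {linear M -> R^o}) (y : 'I_k -> M),
    forall x, b *: x = \sum_i (h i x : R) *: y i.

Lemma dual_basis_tproj b M : dual_basis b M -> tproj b M.
Proof.
move=> [k [h [y hy]]] U V p f hp.
have /choice [u hu] : forall i, exists u, p u = f (y i) by move=> i; apply: hp.
have lg : linear (fun x => \sum_i (h i x : R) *: u i).
  move=> a x z; rewrite scaler_sumr -big_split /=; apply: eq_bigr => i _.
  by rewrite linearP /= scalerDl scalerA.
exists (mklin lg) => x; rewrite -linearZ_LR hy !linear_sum /=;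
  apply: eq_bigr => i _.
by rewrite !linearZ_LR hu.
Qed.

Lemma dual_basis1_projective M : dual_basis 1 M -> projective M.
Proof.
move=> /dual_basis_tproj h U V p f /(h _ _ p f)[g hg].
by exists g => x; rewrite hg scale1r.
Qed.

Lemma dual_basis1_fg M : dual_basis 1 M -> finitely_generated M.
Proof.
move=> [k [h [y hy]]]; exists k, y => x; exists (fun i => h i x).
by rewrite -hy scale1r.
Qed.

(* Equivalently, [c] annihilates [Ext^{n+1}(M, -)]. *)
Definition killed (M : lmodType R) (P : resolution M) (n : nat) (c : R) : Prop :=
  exists r : {linear P n -> P n.+1},
    forall x, rdiff P n (r (rdiff P n x)) = c *: rdiff P n x.

Definition central_scalar (t : R) := forall r, GRing.comm t r.

Lemma central_scalarX t k : central_scalar t -> central_scalar (t ^+ k).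
Proof. by move=> ct r; apply/commr_sym/commrX/commr_sym. Qed.

Lemma scale_comp_linear t (U V : lmodType R) (f : {linear U -> V}) :
  central_scalar t -> linear (fun x => t *: f x).
Proof.
by move=> ct a x y; rewrite linearP scalerDr !scalerA ct.
Qed.

Definition scale_lin t (ct : central_scalar t) (U V : lmodType R)
  (f : {linear U -> V}) : {linear U -> V} := mklin (scale_comp_linear f ct).

(** In degree 0 the differential leaving [P 0] is read as zero, so a map factoring through it
    vanishes. *)
Definition factors_diff (M : lmodType R) (P : resolution M) (i : nat) :
    (P i -> P i) -> Prop :=
  match i with
  | 0 => fun f => forall x, f x = 0
  | j.+1 => fun f => exists k : {linear P j -> P j.+1},
      forall x, f x = k (rdiff P j x)
  end.

Lemma rdiffK M (P : resolution M) i x : rdiff P i (rdiff P i.+1 x) = 0.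
Proof. by apply/(rexactS P); exists x. Qed.

Lemma factors_diff_diff M (P : resolution M) i (f : {linear P i -> P i}) x :
  factors_diff f -> f (rdiff P i x) = 0.
Proof.
case: i f x => [|i] f x /=; first by move=> ->.
by move=> [k ->]; rewrite rdiffK raddf0.
Qed.

(** * Comparison maps and homotopies up to a central scalar *)

Section Comparison.
Variables (t : R) (ct : central_scalar t).
Variables (M N : lmodType R) (P : resolution M) (Q : resolution N).
Hypotheses (hP : forall i, tproj t (P i)) (hQ : forall i, tproj t (Q i)).
Variables (p : {linear M -> N}) (q : {linear N -> M}).
Hypothesis qp : forall x, q (p x) = t *: x.

Lemma lift_diff (M1 N1 : lmodType R) (P1 : resolution M1) (Q1 : resolution N1)
    i (f : {linear P1 i -> Q1 i}) (f' : {linear P1 i.+1 -> Q1 i.+1}) :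
  (forall i, tproj t (P1 i)) ->
  (forall x, rdiff Q1 i (f' x) = f (rdiff P1 i x)) ->
  exists f'' : {linear P1 i.+2 -> Q1 i.+2},
    forall x, rdiff Q1 i.+1 (f'' x) = t *: f' (rdiff P1 i.+1 x).
Proof.
move=> hP1 hf'; apply: (tproj_lift (f := f' \o rdiff P1 i.+1)) => // x /=.
by apply/(rexactS Q1); rewrite hf' rdiffK raddf0.
Qed.

Lemma lift_aug (M1 N1 : lmodType R) (P1 : resolution M1) (Q1 : resolution N1)
    (f : {linear M1 -> N1}) :
  (forall i, tproj t (P1 i)) ->
  exists (f0 : {linear P1 0%N -> Q1 0%N}) (f1 : {linear P1 1%N -> Q1 1%N}),
    (forall x, raug Q1 (f0 x) = t ^+ 2 *: f (raug P1 x)) /\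
    (forall x, rdiff Q1 0 (f1 x) = f0 (rdiff P1 0 x)).
Proof.
move=> hP1.
have [|f0 hf0] := tproj_lift (d := raug Q1) (f := f \o raug P1) (hP1 0%N).
  by move=> x; apply: raug_surj.
have [|f1 hf1] := tproj_lift (d := rdiff Q1 0) (f := f0 \o rdiff P1 0) (hP1 1%N).
  move=> x /=; apply/(rexact0 Q1); rewrite hf0 /=.
  suff -> : raug P1 (rdiff P1 0 x) = 0 by rewrite raddf0 scaler0.
  by apply/(rexact0 P1); exists x.
exists (scale_lin ct f0), f1; split=> x /=; last by rewrite hf1.
by rewrite linearZ_LR hf0 scalerA -expr2.
Qed.

(** The exponent: in degree 0, [lift_aug] costs t^2 for each of the two maps, [qp] costs t, and
    lifting the homotopy costs t, which makes 6. In each further degree [al'] and [be'] are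
    multiplied by t to commute with the next lifts, which costs t^2 and also pays for the lift of
    the homotopy. *)
Lemma comparison i :
  exists (al : {linear P i -> Q i}) (al' : {linear P i.+1 -> Q i.+1})
    (be : {linear Q i -> P i}) (be' : {linear Q i.+1 -> P i.+1})
    (eta : {linear P i -> P i}) (s : {linear P i -> P i.+1}),
  [/\ forall x, rdiff Q i (al' x) = al (rdiff P i x),
      forall x, rdiff P i (be' x) = be (rdiff Q i x),
      factors_diff eta
    & forall x, t ^+ (6 + i * 2) *: x = be (al x) + eta x + rdiff P i (s x)].
Proof.
elim: i => [|i [al [al' [be [be' [eta [s [hal hbe heta hs]]]]]]]].
  have [al [al' [hal hal']]] := lift_aug Q p hP.
  have [be [be' [hbe hbe']]] := lift_aug P q hQ.
  have ct5 : central_scalar (t ^+ 5) by apply: central_scalarX.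
  have [|s hs] := @tproj_lift t _ _ _ (rdiff P 0)
      ((scale_lin ct5 idfun \- (be \o al)) : {linear P 0%N -> P 0%N}) (@hP 0%N).
    move=> x /=; apply/(rexact0 P).
    rewrite linearB linearZ_LR /= hbe hal !linearZ_LR /= qp.
    by rewrite scalerA -exprD scalerN scalerA -exprSr subrr.
  exists al, al', (scale_lin ct be), (scale_lin ct be'), (\0 : {linear _ -> _}), s.
  split=> //= x; first by rewrite linearZ_LR hbe'.
  by rewrite addr0 hs /= scalerBr addrC subrK scalerA -exprS.
have [al'' hal''] := lift_diff hP hal.
have [be'' hbe''] := lift_diff hQ hbe.
have cT : central_scalar (t ^+ (6 + i * 2)) by apply: central_scalarX.
have [|s' hs'] := @tproj_lift t _ _ _ (rdiff P i.+1)
    ((scale_lin cT idfun \- (be' \o al') \- (s \o rdiff P i))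
      : {linear P i.+1 -> P i.+1}) (@hP i.+1).
  move=> x /=; apply/(rexactS P).
  rewrite !linearB linearZ_LR /= hbe hal hs (factors_diff_diff _ heta) addr0.
  by rewrite addrAC addrK subrr.
exists (scale_lin ct al'), al'', (scale_lin ct be'), be''.
exists (scale_lin (central_scalarX 2 ct) (s \o rdiff P i)), (scale_lin ct s').
split=> [x|x||x] /=; rewrite ?hal'' ?hbe'' //.
  by exists (scale_lin (central_scalarX 2 ct) s).
rewrite !linearZ_LR /= hs' /= !scalerA -!expr2 -!scalerDr mulSn addnCA exprD.
by rewrite -scalerA; congr (_ *: _);
  rewrite -[_ - _ - _]addrA -opprD [RHS]addrC subrK.
Qed.

(** The new map is be' r al + c s. On the image of the differential [eta] vanishes, so the homotopy
    identity there reads t^{6+2i} = be al + d s, and multiplying it by [c] gives the claim. *)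
Lemma killed_retract i c : central_scalar c ->
  killed Q i c -> killed P i (c * t ^+ (6 + i * 2)).
Proof.
move=> cc [r hr].
have [al [al' [be [be' [eta [s [hal hbe heta hs]]]]]]] := comparison i.
exists ((be' \o r \o al) \+ scale_lin cc s) => x /=.
rewrite linearD linearZ_LR /= hbe -hal hr linearZ_LR /= hal -scalerDr.
have := hs (rdiff P i x); rewrite (factors_diff_diff _ heta) addr0 => <-.
by rewrite scalerA.
Qed.

End Comparison.

Section Shift.
Variables (M : lmodType R) (P : resolution M).

Lemma img_rdiff x : img_sub (rdiff P 0) (rdiff P 0 x).
Proof. by exists x. Qed.

Lemma shift_surj (z : subm (img_sub (rdiff P 0))) :
  exists x, corestrict img_rdiff x = z.
Proof. by have [x hx] := submP z; exists x; apply/val_inj. Qed.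

Lemma shift_exact0 x : corestrict img_rdiff x = 0 <-> exists y, rdiff P 1 y = x.
Proof.
rewrite -(rexactS P); split=> [/(congr1 val) //|h].
exact/val_inj.
Qed.

Definition shift : resolution (subm (img_sub (rdiff P 0))) :=
  @Resolution _ (fun i => P i.+1) (fun i => rdiff P i.+1) (corestrict img_rdiff)
    shift_surj shift_exact0 (fun i x => rexactS P (i := i.+1) x).

End Shift.

(** Dimension shifting: [shift P] resolves the first syzygy, which is again finitely generated. *)
Lemma killed_shift n c :
  (forall (M : lmodType R) (P : resolution M), finitely_generated M ->
     (forall i, dual_basis 1 (P i)) -> killed P n c) ->
  forall j (M : lmodType R) (P : resolution M), finitely_generated M ->
     (forall i, dual_basis 1 (P i)) -> killed P (j + n) c.
Proof.
move=> h; elim=> [|j IHj] M P fM hP; first exact: h.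
apply: (IHj _ (shift P)) => [|i]; last exact: hP.
exact: (fg_surj (@shift_surj _ P) (dual_basis1_fg (hP 1%N))).
Qed.

Lemma dual_basis1_rV k : dual_basis 1 'rV[R]_k.
Proof.
have lc (j : 'I_k) : linear (fun x : 'rV[R]_k => x 0 j : R^o).
  by move=> a x y; rewrite !mxE.
exists k, (fun j => mklin (lc j)), (fun j => delta_mx 0 j) => x.
by rewrite scale1r {1}(row_sum_delta x).
Qed.

(** * Resolutions by finitely generated free modules *)

Section FreeResolution.
Hypothesis noethR : forall (U V : lmodType R) (f : {linear U -> V}),
  injective f -> finitely_generated V -> finitely_generated U.

Let fgmod := {X : lmodType R | finitely_generated X}.

Lemma free_cover (X : fgmod) :
  {k : nat & {f : {linear 'rV[R]_k -> sval X} | forall y, exists x, f x = y}}.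
Proof.
case: X => X /= /cid [k /cid [e he]]; exists k.
have lf : linear (fun c : 'rV[R]_k => \sum_i c 0 i *: e i).
  move=> a x y; rewrite scaler_sumr -big_split /=; apply: eq_bigr => i _.
  by rewrite !mxE scalerDl scalerA.
exists (mklin lf) => y; have [c ->] := he y; exists (\row_i c i).
by apply: eq_bigr => i _; rewrite mxE.
Qed.

Let cover (X : fgmod) := projT2 (free_cover X).

Lemma syzygy_fg (X : fgmod) : finitely_generated (subm (ker_sub (sval (cover X)))).
Proof.
apply: (noethR (f := subm_lin _)); first exact: val_inj.
exact/dual_basis1_fg/dual_basis1_rV.
Qed.

Let syzygy (X : fgmod) : fgmod := exist _ _ (syzygy_fg X).

Lemma free_resolution (M : lmodType R) : finitely_generated M ->
  exists P : resolution M, forall i, dual_basis 1 (P i).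
Proof.
move=> fM; pose X i := iter i syzygy (exist _ M fM : fgmod).
pose F i : lmodType R := 'rV[R]_(projT1 (free_cover (X i))).
pose d' i := sval (cover (X i)).
pose d i : {linear F i.+1 -> F i} := subm_lin _ \o d' i.+1.
have exd i (x : F i) : d' i x = 0 <-> exists y, d i y = x.
  split=> [h|[y <-]]; last exact: (submP (d' i.+1 y)).
  have [y hy] := proj2_sig (cover (X i.+1)) (subm_in (S := ker_sub (d' i)) h).
  by exists y; rewrite /d /= /d' hy.
have exS i (x : F i.+1) : d i x = 0 <-> exists y, d i.+1 y = x.
  rewrite -exd; split=> h; first exact/val_inj.
  by rewrite /d /= h.
exists (@Resolution M F d (d' 0%N) (proj2_sig (cover (X 0%N))) (exd 0%N) exS) => i.
exact: dual_basis1_rV.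
Qed.

End FreeResolution.

End Resolutions.

Arguments raug_surj {R M} r m.
Arguments rexact0 {R M} r x.
Arguments rexactS {R M} r {i} x.

(** * Annihilators of Ext *)

Section CohomologyAnnihilator.
Variable L : pzRingType.

Lemma center_val_central (c : ring_center L) : central_scalar (center_val c : L^c).
Proof. by move=> x; apply/esym/(centralP _ (valP c)). Qed.

Lemma nonzerodivisor_center (c : ring_center L) x :
  nonzerodivisor c -> (forall y, x * y = y * x) -> center_val c * x = 0 -> x = 0.
Proof.
move=> c_nzd xC cx; have xc : x \in @central L by apply/centralP.
have c0 : c * Center xc = 0 by apply/val_inj.
by have /(congr1 val) := c_nzd _ c0.
Qed.

(** Tested on the universal class, that of the differential as a cocycle with values in its own
    image. Its multiple by [c] is a coboundary [g] composed with the differential, and a lift of [g]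
    to [P n.+1] is the required map. *)
Lemma ca_killed n (c : ring_center L) (M : lmodType L^c) (P : resolution M) :
  ca n.+1 c -> finitely_generated M -> (forall i, dual_basis 1 (P i)) ->
  killed P n (center_val c : L^c).
Proof.
move=> hc fM hP.
pose P' := Build_projective_resolution
  (fun i => dual_basis1_projective (hP i)) (raug_surj P) (rexact0 P) (fun i => rexactS P (i := i)).
pose I := subm (img_sub (rdiff P n)).
have hI x : img_sub (rdiff P n) (rdiff P n x) by exists x.
pose f : linhom (P' n.+1) I := corestrict hI.
have fI : finitely_generated I.
  apply: (fg_surj (f := corestrict hI)) (dual_basis1_fg (hP n.+1)) => z.
  by have [x hx] := submP z; exists x; apply/val_inj.
have hf : f \in @is_cocycle L M P' I n.+1.
  by apply/asboolP => x; apply/val_inj; rewrite /= rdiffK.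
have := hc M I fM fI P' n.+1 (leqnn _) (\pi_(Ext P' I n.+1) (Cocycle hf)).
rewrite [_ *: _]Ext_scaleE => /Ext_eq0 [g hg].
have [x|r hr] := tproj_lift (d := rdiff P n)
  (f := subm_lin _ \o (g : {linear P n -> I}))
  (tproj1 (dual_basis1_projective (hP n))).
  exact: (@submP _ _ (img_sub (rdiff P n)) (g x)).
exists r => x; rewrite hr scale1r /=.
by have /(congr1 val) /= <- := hg x.
Qed.

(** The element c x - r(d x) is a cycle, hence a boundary, so the cocycle f vanishes on it. Thus c f
    = (f r) d is a coboundary. *)
Lemma killed_Ext0 n (c : ring_center L) (M N : lmodType L^c)
    (P : projective_resolution M) (x : Ext P N n.+1) :
  killed (of_projective_resolution P) n (center_val c : L^c) -> c *: x = 0.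
Proof.
move=> [r hr]; elim/Ext_ind: x => -[f hf].
rewrite [_ *: _]Ext_scaleE; apply/Ext_eq0; move/asboolP: (hf) => hf'.
exists (f \o r : {linear _ -> _}) => x.
have [y hy] : exists y, res_diff P n.+1 y = (center_val c : L^c) *: x - r (res_diff P n x).
  by apply/(res_exactS (p := P)); rewrite linearB linearZ_LR /= hr subrr.
have := hf' y; rewrite hy linearB linearZ_LR /= => /subr0_eq; exact.
Qed.

(** An arbitrary projective resolution is compared with a free one by [killed_retract] for t = 1;
    [killed_shift] supplies the higher degrees. *)
Lemma ca_intro n (c : ring_center L) :
  (forall (U V : lmodType L^c) (f : {linear U -> V}),
     injective f -> finitely_generated V -> finitely_generated U) ->
  (forall (M : lmodType L^c) (P : resolution M), finitely_generated M ->
     (forall i, dual_basis 1 (P i)) -> killed P n (center_val c : L^c)) ->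
  ca n.+1 c.
Proof.
move=> noethL hc M N fM fN P [//|i] hi x; apply: killed_Ext0.
have [F hF] := free_resolution noethL fM.
have c1 : central_scalar (1 : L^c) by move=> r; apply: commr_sym; apply: commr1.
have := killed_shift hc (i - n) fM hF; rewrite subnK // => hk.
have := @killed_retract _ 1 c1 M M (of_projective_resolution P) F
  (fun j => tproj1 (@res_projective _ _ P j)) (fun j => dual_basis_tproj (hF j))
  idfun idfun (fun y => esym (scale1r y)) i _ (center_val_central c) hk.
by rewrite expr1n mulr1.
Qed.

End CohomologyAnnihilator.
(** * Finite algebras over a noetherian ring *)

Lemma dual_basis_fin (R : pzRingType) (b : R) (M : lmodType R) (I : finType)
    (h : I -> {linear M -> R^o}) (y : I -> M) :
  (forall x, b *: x = \sum_i (h i x : R) *: y i) -> dual_basis b M.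
Proof.
move=> hy; exists #|I|, (fun i => h (enum_val i)), (fun i => y (enum_val i)) => x.
by rewrite hy (reindex (@enum_val I I)) //; apply/onW_bij/enum_val_bij.
Qed.

Section RestrictResolution.
Variables (A : comPzRingType) (L : pzRingType) (rho : {rmorphism A -> L}).

Definition restr_resolution (M : lmodType L^c) (P : resolution M) :
    resolution (restr rho M) :=
  @Resolution A (restr rho M) (fun i => restr rho (P i))
    (fun i => restr_lin rho (rdiff P i)) (restr_lin rho (raug P))
    (raug_surj P) (rexact0 P) (fun i => rexactS P (i := i)).

Definition regmod : lmodType A := restr rho (L^c)^o.

Lemma restrE (M : lmodType L^c) (a : A) (x : restr rho M) :
  a *: x = (rho a : L^c) *: (x : M).
Proof. by []. Qed.

Lemma orbit_linear (M : lmodType L^c) (m : M) :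
  linear (fun l : regmod => (l : L^c) *: m : restr rho M).
Proof.
move=> a x y; rewrite !restrE scalerA.
exact: (scalerDl m ((rho a : L^c) * (x : L^c)) (y : L^c)).
Qed.

Definition orbit_lin (M : lmodType L^c) (m : M) : {linear regmod -> restr rho M} :=
  mklin (orbit_linear m).

Lemma restr_fg (M : lmodType L^c) : finitely_generated regmod ->
  finitely_generated M -> finitely_generated (restr rho M).
Proof.
move=> [k [l hl]] [r [e he]]; apply/fg_lspan.
pose T := [seq (orbit_lin (e ij.1) (l ij.2)) | ij <- enum {: 'I_r * 'I_k}].
exists T => x; have [c ->] := he x.
apply: (smem_bigsum (S := lspan_sub T)) => i.
have [a ha] := hl (c i).
rewrite -[c i *: e i]/(orbit_lin (e i) (c i)) ha linear_sum.
apply: (smem_bigsum (S := lspan_sub T)) => j; rewrite linearZ_LR -[_ *: _]addr0.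
apply: smemD; last exact: smem0.
by apply: mem_lspan;
  apply: (map_f (fun ij => orbit_lin (e ij.1) (l ij.2)) (x := (i, j)));
    rewrite mem_enum.
Qed.

Lemma fg_restr (M : lmodType L^c) :
  finitely_generated (restr rho M) -> finitely_generated M.
Proof.
move=> [r [e he]]; exists r, e => x; have [c hc] := he x.
by exists (fun i => rho (c i)).
Qed.

Lemma fg_inj_restr (U V : lmodType L^c) (f : {linear U -> V}) :
  noetherian A -> finitely_generated regmod ->
  injective f -> finitely_generated V -> finitely_generated U.
Proof.
move=> noethA fL injf fV; apply: fg_restr.
exact: (fg_inj noethA (f := restr_lin rho f) injf (restr_fg fL fV)).
Qed.

Lemma restr_dual_basis t (P : lmodType L^c) :
  dual_basis t regmod -> dual_basis 1 P -> dual_basis t (restr rho P).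
Proof.
move=> [k [g [l hl]]] [r [h [y hy]]].
pose h' (ij : 'I_r * 'I_k) : {linear restr rho P -> A^o} :=
  g ij.2 \o restr_lin rho (h ij.1).
apply: (@dual_basis_fin _ _ _ _ h' (fun ij => orbit_lin (y ij.1) (l ij.2))) => x.
rewrite -(pair_bigA _ (fun i j => (h' (i, j) x : A) *: orbit_lin (y i) (l j))) /=.
have {1}-> : x = \sum_i orbit_lin (y i) (h i x : regmod).
  by rewrite -[x in LHS](scale1r (x : P)) hy.
rewrite scaler_sumr; apply: eq_bigr => i _.
rewrite -linearZ_LR hl linear_sum; apply: eq_bigr => j _.
by rewrite linearZ_LR.
Qed.

(* A homotopy that is only [A]-linear is made [L]-linear by averaging over     *)
(* [\sum_i p i (x) q i], a separability element up to the scalars [d] and [e]. *)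
Lemma killed_separable (k : nat) (p q : 'I_k -> L) (C : L -> 'I_k -> 'I_k -> A)
    (d e : A) (M : lmodType L^c) (P : resolution M) n b :
  (forall a x, rho a * x = x * rho a) ->
  (forall s i, rho d * (s * q i) = \sum_j rho (C s i j) * q j) ->
  (forall s j, rho d * (p j * s) = \sum_i rho (C s i j) * p i) ->
  \sum_i q i * p i = rho e ->
  killed (restr_resolution P) n b -> killed P n (rho (d * e * b) : L^c).
Proof.
move=> cA hq hp hpq [r hr].
(* In right-module notation, f(x) is the sum of d r(x q_i) p_i. The factor [d] is what lets [hq] and
   [hp] carry a scalar s from one side to the other. *)
pose f x : P n.+1 :=
  \sum_i (p i : L^c) *: ((d *: r ((q i : L^c) *: x) : restr rho _) : P n.+1).
have mulcE (x y : L) : (x : L^c) * (y : L^c) = y * x by [].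
have rD (x y : P n) : r (x + y) = (r x : P n.+1) + (r y : P n.+1) :> P n.+1.
  exact: (raddfD r (x : restr rho (P n)) y).
have rZ (a : A) (x : P n) :
    r ((rho a : L^c) *: x) = (rho a : L^c) *: (r x : P n.+1) :> P n.+1.
  exact: (linearZ_LR r a (x : restr rho (P n))).
have rsum (I : finType) (F : I -> P n) :
    r (\sum_i F i) = \sum_i (r (F i) : P n.+1) :> P n.+1.
  exact: (big_morph (fun x => r x : P n.+1) rD (raddf0 r)).
have lf : linear f.
  move=> s x y; rewrite /f scaler_sumr.
  transitivity (\sum_i
      ((p i : L^c) *: ((rho d : L^c) *: (r ((q i : L^c) *: (s *: x)) : P n.+1))
     + (p i : L^c) *: ((rho d : L^c) *: (r ((q i : L^c) *: y) : P n.+1)))).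
    apply: eq_bigr => i _; rewrite !restrE scalerDr rD.
    by rewrite (scalerDr (rho d : L^c)) scalerDr.
  rewrite big_split /=; congr (_ + _).
  transitivity (\sum_i \sum_j
      (p i : L^c) *: ((rho (C s i j) : L^c) *: (r ((q j : L^c) *: x) : P n.+1))).
    apply: eq_bigr => i _.
    rewrite -rZ !scalerA -scaler_sumr; congr (_ *: _).
    have -> : (rho d : L^c) * (q i : L^c) * s = \sum_j (rho (C s i j) * q j : L).
      by rewrite -hq; exact: (etrans (mulrA _ _ _) (esym (cA _ _))).
    rewrite scaler_suml rsum; apply: eq_bigr => j _.
    by rewrite cA -rZ scalerA.
  rewrite exchange_big; apply: eq_bigr => j _ /=.
  under eq_bigr => i _ do rewrite scalerA.
  rewrite -scaler_suml restrE !scalerA; congr (_ *: _). 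
  transitivity (\sum_i (rho (C s i j) * p i : L)); first by [].
  by rewrite -hp.
exists (mklin lf) => x; rewrite /= /f linear_sum.
transitivity (\sum_i (rho (d * b) : L^c) *: (((q i * p i : L) : L^c) *: rdiff P n x)).
  apply: eq_bigr => i _.
  rewrite linearZ_LR restrE linearZ_LR.
  have := hr ((q i : L^c) *: x).
  rewrite /= linearZ_LR !restrE => ->.
  rewrite !scalerA; congr (_ *: _).
  have E : q i * (rho b * (rho d * p i)) = q i * p i * rho (d * b).
    by rewrite [rho b * _]mulrA -rmorphM cA mulrA (mulrC b).
  exact: E.
rewrite -scaler_sumr -scaler_suml hpq.
have -> : d * e * b = e * (d * b) by rewrite mulrA (mulrC e).
by rewrite scalerA; congr (_ *: _); apply: (esym (rmorphM rho e (d * b))).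
Qed.

End RestrictResolution.

(** * Annihilation transferred between two algebras over the base ring *)

Section Transfer.
Variables (A : comPzRingType) (L L' : pzRingType).
Variables (rho : {rmorphism A -> L}) (rho' : {rmorphism A -> L'}) (t : A).
Hypotheses (bL : dual_basis t (regmod rho)) (bL' : dual_basis t (regmod rho')).
Variables (M : lmodType L^c) (X : lmodType L'^c).
Variables (P : resolution M) (Q : resolution X).
Hypotheses (hP : forall i, dual_basis 1 (P i)) (hQ : forall i, dual_basis 1 (Q i)).
Variables (p : {linear restr rho' X -> restr rho M}).
Variables (q : {linear restr rho M -> restr rho' X}).
Hypothesis qp : forall x, q (p x) = t *: x.

Lemma central_scalar_com (c : A) : central_scalar c.
Proof. by move=> r; apply: mulrC. Qed.

Lemma transfer_killed n a :
  killed (restr_resolution rho P) n a ->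
  killed (restr_resolution rho' Q) n (a * t ^+ (6 + n * 2)).
Proof.
apply: (killed_retract (central_scalar_com t) _ _ qp (central_scalar_com a)) => i.
  exact: (dual_basis_tproj (restr_dual_basis bL' (@hQ i))).
exact: (dual_basis_tproj (restr_dual_basis bL (@hP i))).
Qed.

End Transfer.
(** * Rank and approximate bases *)

Lemma common_multiple (A : comPzRingType) (S : A -> Prop) (I : finType)
    (P : I -> A -> Prop) :
  S 1 -> (forall a b, S a -> S b -> S (a * b)) ->
  (forall i a b, P i a -> P i (b * a)) ->
  (forall i, exists2 a, S a & P i a) -> exists2 a, S a & forall i, P i a.
Proof.
move=> S1 SM PM h.
have /choice [g gP] : forall i, exists a, S a /\ P i a.
  by move=> i; have [a] := h i; exists a.
exists (\prod_i g i).
  by apply: (big_ind S) => // i _; have [] := gP i.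
by move=> i; rewrite (bigD1 i) //= mulrC; apply: PM; have [] := gP i.
Qed.

(** After inverting [d], the [m i] form a basis with coordinate functions [f i] divided by [d]. *)
Definition approx_basis (A : comPzRingType) (V : lmodType A) (d : A) (r : nat)
    (m : 'I_r -> V) (f : 'I_r -> {linear V -> A^o}) : Prop :=
  (forall i j, f i (m j) = d *+ (i == j)) /\
  (forall x, d *: x = \sum_i (f i x : A) *: m i).

Section Rank.
Variables (A : comPzRingType) (V : lmodType A).
Local Notation Q := (totfrac A).
Local Notation frac := (@to_totfrac A).
Local Notation VQ := (base_change frac V).

Let fracM a b : frac (a * b) = frac a * frac b. Proof. exact: rmorphM. Qed.
Let fracD a b : frac (a + b) = frac a + frac b. Proof. exact: rmorphD. Qed.
Let frac0 : frac 0 = 0. Proof. exact: rmorph0. Qed.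
Let fracN1 : frac (-1) = -1. Proof. exact: rmorphN1. Qed.
Let fracMn a k : frac (a *+ k) = frac a *+ k. Proof. exact: rmorphMn. Qed.
Let frac_sum (I : finType) (F : I -> A) : frac (\sum_i F i) = \sum_i frac (F i).
Proof. exact: rmorph_sum. Qed.

Lemma to_totfrac_inj : injective frac.
Proof. by move=> a b /totfracP /=; rewrite !mulr1. Qed.

Lemma clear_denominator (q : Q) :
  exists2 D, nonzerodivisor D & exists a, frac a = frac D * q.
Proof.
elim/totfrac_ind: q => x; exists (tden x); first exact: tdenP.
exists (tnum x); rewrite [RHS]totfrac_mulE; apply/totfracP => /=.
by rewrite mul1r mulr1 mulrC.
Qed.

(* [clears D s v]: multiplying the coefficients of the formal sum [s] by [D]  *)
(* makes them elements of [A], and the resulting sum in [V] is [v].           *)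
Fixpoint clears (D : A) (s : seq (Q * V)) (v : V) : Prop :=
  if s is x :: s' then
    exists a w, [/\ frac a = frac D * x.1, clears D s' w & v = a *: x.2 + w]
  else v = 0.

Lemma clears_scale D E s v : clears D s v -> clears (E * D) s (E *: v).
Proof.
elim: s v => /= [v ->|x s IHs v [a [w [ha /IHs hw ->]]]]; first exact: scaler0.
exists (E * a), (E *: w); split=> //; last by rewrite scalerDr scalerA.
by rewrite !fracM ha mulrA.
Qed.

Lemma clears_exists s : exists2 D, nonzerodivisor D & exists v, clears D s v.
Proof.
elim: s => [|x s [D hD [v hv]]]; first by exists 1;
  [apply: nonzerodivisor1 | exists 0].
have [E hE [a ha]] := clear_denominator x.1.
exists (E * D); first exact: nonzerodivisorM.
exists ((D * a) *: x.2 + E *: v), (D * a), (E *: v); split=> //.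
  by rewrite !fracM ha mulrCA mulrA.
exact: clears_scale.
Qed.

Lemma clears_cat D s t v : clears D (s ++ t) v <->
  exists v1 v2, [/\ clears D s v1, clears D t v2 & v = v1 + v2].
Proof.
elim: s v => [v|x s IHs v] /=.
  split=> [h|[_ [v2 [-> h ->]]]]; last by rewrite add0r.
  by exists 0, v; rewrite add0r.
split=> [[a [w [ha /IHs [v1 [v2 [h1 h2 ->]]] ->]]]|[v1 [v2 [[a [w [ha hw ->]]] h2 ->]]]].
  by exists (a *: x.2 + v1), v2; rewrite addrA; split=> //; exists a, v1.
exists a, (w + v2); rewrite addrA; split=> //.
by apply/IHs; exists w, v2.
Qed.

Lemma clears_uniq D D' s v v' :
  clears D s v -> clears D' s v' -> D' *: v = D *: v'.
Proof.
elim: s v v' => /= [v v' -> ->|x s IHs v v' [a [w [ha hw ->]]] [a' [w' [ha' hw' ->]]]].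
  by rewrite !scaler0.
rewrite !scalerDr !scalerA (IHs _ _ hw hw'); congr (_ *: _ + _).
by apply: to_totfrac_inj; rewrite !fracM ha ha' mulrCA.
Qed.

(** Induction on the congruence. The factor [e] arises from transitivity, where the denominator of
    the intermediate formal sum has to be carried along. With D = D' = 1 this says that the kernel
    of V -> Q (x) V is torsion. *)
Lemma tensor_rel_clears s t D v D' v' : tensor_rel frac s t ->
  clears D s v -> clears D' t v' ->
  exists2 e, nonzerodivisor e & e *: (D' *: v) = e *: (D *: v').
Proof.
have nzd1 := @nonzerodivisor1 A.
move=> st; elim: st D v D' v' => {s t} /=.
- by move=> s D v D' v' h h'; exists 1; rewrite // (clears_uniq h h').
- by move=> s t _ IH D v D' v' h h'; have [e he ee] := IH _ _ _ _ h' h; exists e.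
- move=> s t u _ IH1 _ IH2 D v D' v' h h'.
  have [E hE [w hw]] := clears_exists t.
  have [e1 h1 ee1] := IH1 _ _ _ _ h hw.
  have [e2 h2 ee2] := IH2 _ _ _ _ hw h'.
  exists (e1 * e2 * E); first by do !apply: nonzerodivisorM.
  transitivity ((e2 * D') *: (e1 *: (E *: v))).
    by rewrite !scalerA; congr (_ *: _); ring.
  transitivity ((e1 * D) *: (e2 *: (D' *: w))).
    by rewrite ee1 !scalerA; congr (_ *: _); ring.
  by rewrite ee2 !scalerA; congr (_ *: _); ring.
- move=> s s' t t' _ IH1 _ IH2 D v D' v'.
  move=> /clears_cat [v1 [v2 [h1 h2 ->]]] /clears_cat [w1 [w2 [k1 k2 ->]]].
  have [e1 he1 ee1] := IH1 _ _ _ _ h1 k1.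
  have [e2 he2 ee2] := IH2 _ _ _ _ h2 k2.
  exists (e1 * e2); first exact: nonzerodivisorM.
  rewrite !scalerDr -!(scalerA e1 e2) ee2; congr (_ + _).
  by rewrite !(scalerA e1 e2) mulrC -!scalerA ee1.
- move=> s t D v D' v' /clears_cat [v1 [v2 [h1 h2 ->]]] h'.
  exists 1 => //; congr (_ *: _); apply: clears_uniq h'.
  by apply/clears_cat; exists v2, v1; rewrite addrC.
- move=> m D v D' v' [a [w [ha -> ->]]] ->; exists 1 => //.
  have -> : a = 0 by apply: to_totfrac_inj; rewrite ha mulr0 frac0.
  by rewrite scale0r addr0 !scaler0.
- move=> b c m D v D' v' [a [w [ha -> ->]]].
  move=> [a1 [_ [h1 [a2 [_ [h2 -> ->]]] ->]]].
  exists 1 => //; congr (_ *: _); rewrite !addr0 -scalerDl !scalerA; congr (_ *: _).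
  by apply: to_totfrac_inj; rewrite !fracM fracD ha h1 h2 -mulrDr mulrCA.
- move=> b m m' D v D' v' [a [w [ha -> ->]]].
  move=> [a1 [_ [h1 [a2 [_ [h2 -> ->]]] ->]]].
  exists 1 => //; congr (_ *: _); rewrite !addr0 !scalerDr !scalerA.
  by congr (_ *: _ + _ *: _); apply: to_totfrac_inj;
    rewrite !fracM ha ?h1 ?h2 mulrCA.
- move=> b a m D v D' v' [c [w [hc -> ->]]] [c' [_ [hc' -> ->]]].
  exists 1 => //; congr (_ *: _); rewrite !addr0 !scalerA; congr (_ *: _).
  by apply: to_totfrac_inj; rewrite !fracM hc hc' !mulrA (mulrC (frac D')).
Qed.

Definition to_base_change (v : V) : VQ := \pi_VQ [:: (1, v)].

Lemma to_base_change_eq0 v :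
  to_base_change v = 0 -> exists2 e, nonzerodivisor e & e *: v = 0.
Proof.
move=> /base_changeP h.
have [||e he] := @tensor_rel_clears _ _ 1 v 1 0 h => //.
  by exists 1, 0; rewrite mulr1 scale1r addr0.
by rewrite !scaler0 scale1r => ev; exists e.
Qed.

Lemma to_base_change_linear (a : A) u v :
  to_base_change (a *: u + v) = frac a *: to_base_change u + to_base_change v.
Proof.
rewrite [frac a *: _]tensor_scaleqE [_ + \pi_VQ _]tensor_addqE /=.
apply/base_changeP; apply: tensor_trans (tensor_addr _ _ _ _) _.
apply: (@tensor_cat _ _ _ _ [:: _] [:: _] [:: _] [:: _]); last exact: tensor_refl.
by apply: tensor_sym; rewrite mulr1 -{1}[frac a]mul1r; apply: tensor_bal.
Qed.

Lemma clearsE D s v : clears D s v -> frac D *: (\pi_VQ s) = to_base_change v.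
Proof.
elim: s v => [v /= ->|[q m] s IHs v /= [a [w [ha hw ->]]]].
  rewrite [LHS]tensor_scaleqE /=; apply/base_changeP/tensor_sym.
  have := @tensor_bal _ _ frac V 1 0 0; rewrite scale0r rmorph0 mulr0 => h.
  exact: tensor_trans (tensor_sym h) (tensor_zero _ _).
rewrite to_base_change_linear -(IHs _ hw) ha.
have -> : \pi_VQ ((q, m) :: s) = \pi_VQ [:: (q, m)] + \pi_VQ s.
  by rewrite [RHS]tensor_addqE.
rewrite scalerDr; congr (_ + _).
by rewrite [LHS]tensor_scaleqE [RHS]tensor_scaleqE /= mulr1.
Qed.

Lemma to_base_change_den (x : VQ) :
  exists2 D, nonzerodivisor D & exists v, frac D *: x = to_base_change v.
Proof.
elim/base_change_ind: x => s; have [D hD [v hv]] := clears_exists s.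
by exists D => //; exists v; apply: clearsE.
Qed.

(** The [m i] come from the standard basis of Q^r and the [f i] from the coordinates of [phi], with
    denominators [D] and [D'] cleared. Orthogonality holds because A embeds in Q. The expansion of a
    vector holds at first only modulo torsion; a further [e] kills the error on the finitely many
    generators, hence everywhere. *)
Lemma rank_approx_basis r : finitely_generated V -> has_rank V r ->
  exists d (m : 'I_r -> V) (f : 'I_r -> {linear V -> A^o}),
    nonzerodivisor d /\ approx_basis d m f.
Proof.
move=> [k [g hg]] [phi bphi]; have injphi := bij_inj bphi.
have nzd1 := @nonzerodivisor1 A.
have [psi _ phiK] := bphi.
pose x i := psi (delta_mx 0 i).
have [D hD /choice [m hm]] : exists2 D, nonzerodivisor D &
    forall i, exists v, frac D *: x i = to_base_change v.
  apply: common_multiple nzd1 _ _ _ => [||i]; first exact: nonzerodivisorM.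
    move=> i a b [v hv]; exists (b *: v + 0).
    rewrite to_base_change_linear -hv scalerA fracM.
    suff -> : to_base_change 0 = 0 by rewrite addr0.
    by rewrite -(@clearsE 1 [::] 0) // [LHS]tensor_scaleqE.
  exact: to_base_change_den.
pose c v i := phi (to_base_change v) 0 i.
have cP a u v i : c (a *: u + v) i = frac a * c u i + c v i.
  by rewrite /c to_base_change_linear linearP !mxE.
have c0 i : c 0 i = 0.
  by have := cP (-1) 0 0 i; rewrite scaler0 addr0 fracN1 mulN1r addNr.
have csum (I : finType) (a : I -> A) (u : I -> V) i :
    c (\sum_j a j *: u j) i = \sum_j frac (a j) * c (u j) i.
  elim/big_rec2: _ => [|j y1 y2 _ <-]; [exact: c0 | exact: cP].
have [D' hD' hf] : exists2 D', nonzerodivisor D' &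
    forall li : 'I_k * 'I_r, exists a, frac a = frac D' * c (g li.1) li.2.
  apply: common_multiple nzd1 _ _ _ => [||li]; first exact: nonzerodivisorM.
    by move=> li a b [e he]; exists (b * e); rewrite !fracM he mulrA.
  exact: clear_denominator.
have /choice [f hf'] : forall vi : V * 'I_r, exists a, frac a = frac D' * c vi.1 vi.2.
  move=> [v i] /=; have /choice [b hb] := hf.
  have [e ->] := hg v; exists (\sum_j e j * b (j, i)).
  rewrite csum frac_sum mulr_sumr; apply: eq_bigr => j _.
  by rewrite fracM (hb (j, i)) mulrCA.
have lf i : linear (fun v => f (v, i) : A^o).
  move=> a u v; apply: to_totfrac_inj.
  by rewrite fracD fracM !hf' /= cP mulrDr mulrCA.
have cm i j : c (m j) i = frac D *+ (i == j).
  by rewrite /c -hm linearZ_LR /= phiK !mxE eqxx /= eq_sym mulr_natr.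
pose d := D' * D.
have hbasis v : exists2 e, nonzerodivisor e &
    e *: (d *: v - \sum_i f (v, i) *: m i) = 0.
  apply: to_base_change_eq0; apply: injphi; rewrite raddf0; apply/rowP => i.
  rewrite mxE -[LHS]/(c _ i) -scaleN1r addrC cP csum fracN1 mulN1r.
  rewrite (bigD1 i) //= big1 ?addr0 => [|j /negPf ji]; last first.
    by rewrite cm eq_sym ji mulr0.
  rewrite cm eqxx mulr1n hf' /= -[d *: v]addr0 cP c0 addr0 fracM.
  by rewrite mulrAC addNr.
have [e he hge] : exists2 e, nonzerodivisor e &
    forall l, e *: (d *: g l - \sum_i f (g l, i) *: m i) = 0.
  apply: common_multiple nzd1 _ _ _ => [||l]; first exact: nonzerodivisorM.
    by move=> l a b h; rewrite -scalerA h scaler0.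
  exact: hbasis.
exists (e * d), m, (fun i => e \*: mklin (lf i)); split.
  by do !apply: nonzerodivisorM.
split=> [i j|v] /=.
  rewrite -mulrnAr; congr (_ * _); apply: to_totfrac_inj.
  by rewrite hf' /= cm fracMn fracM mulrnAr.
have lG : linear (fun v => e *: (d *: v - \sum_i f (v, i) *: m i)).
  move=> a u w /=; rewrite scalerA [a * e]mulrC -[(e * a) *: _]scalerA -scalerDr.
  congr (_ *: _).
  rewrite scalerBr scalerDr !scalerA mulrC addrACA -opprD; congr (_ - _).
  rewrite scaler_sumr -big_split /=; apply: eq_bigr => i _.
  by rewrite (lf i a u w) scalerDl scalerA.
have /eqP : mklin lG v = 0.
  have [b ->] := hg v; rewrite linear_sum big1 // => l _.
  by rewrite linearZ_LR /= hge scaler0.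
rewrite /= scalerBr subr_eq0 scalerA => /eqP ->; rewrite scaler_sumr.
by apply: eq_bigr => i _; rewrite scalerA.
Qed.

End Rank.
(** * Modules over the localization at an associated prime *)

Section AssociatedPrime.
Variables (A : comPzRingType) (s : A).

(* [u] is not in [p := ann(s)], which the hypotheses below make a prime ideal. *)
Definition off (u : A) : Prop := s * u <> 0.

Hypothesis off1 : off 1.
Hypothesis offM : forall u v, off u -> off v -> off (u * v).

Lemma off_mul_eq0 u a : off u -> s * (u * a) = 0 -> s * a = 0.
Proof. by move=> hu; apply: contraPP => ha; apply: offM. Qed.

Lemma offB u a : off u -> s * a = 0 -> off (u - a).
Proof. by move=> hu ha; rewrite /off mulrBr ha subr0. Qed.

Lemma nonzerodivisor_off t : nonzerodivisor t -> off t.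
Proof. by move=> ht; rewrite /off mulrC => /ht s0; apply: off1;
  rewrite s0 mul0r. Qed.

(* Membership in [pV], impredicatively. *)
Definition pmul (V : lmodType A) (x : V) : Prop :=
  forall S : submodule V, (forall a v, s * a = 0 -> S (a *: v)) -> S x.

Lemma pmul0 (V : lmodType A) : pmul (0 : V).
Proof. by move=> S _; apply: smem0. Qed.

Lemma pmulD (V : lmodType A) a (x y : V) : pmul x -> pmul y -> pmul (a *: x + y).
Proof. by move=> hx hy S hS; apply: smemD; [apply: hx | apply: hy]. Qed.

Definition pmul_sub (V : lmodType A) := Submodule (@pmul0 V) (@pmulD V).

Lemma pmul_scale (V : lmodType A) a (v : V) : s * a = 0 -> pmul (a *: v).
Proof. by move=> ha S; apply. Qed.

Lemma pmul_lin (V W : lmodType A) (f : {linear V -> W}) x : pmul x -> pmul (f x).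
Proof.
move=> hx S hS.
have SD a y z : S (f y) -> S (f z) -> S (f (a *: y + z)).
  by move=> hy hz; rewrite linearP; apply: smemD.
have S0 : S (f 0) by rewrite raddf0; apply: smem0.
by apply: (hx (@Submodule _ _ (fun x => S (f x)) S0 SD)) => a v ha /=;
  rewrite linearZ_LR; apply: hS.
Qed.

(* Over the localization at [p], the canonical surjection [V/pV -> sV] is     *)
(* bijective.                                                                 *)
Definition good (V : lmodType A) : Prop :=
  forall v : V, s *: v = 0 -> exists2 u, off u & pmul (u *: v).

(** If s v = 0, then [s] kills every coordinate [h i v], so all of them lie in p. *)
Lemma dual_basis_good (V : lmodType A) b : off b -> dual_basis b V -> good V.
Proof.
move=> hb [k [h [y hy]]] v sv; exists b => //; rewrite hy.
apply: (smem_bigsum (S := pmul_sub V)) => i; apply: pmul_scale.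
by have := linearZ_LR (h i) s v; rewrite sv raddf0.
Qed.

(** * Nakayama's lemma and minimal generators at the prime *)

Section Nakayama.
Variable V : lmodType A.

Fixpoint pspan (ws : seq V) (x : V) : Prop :=
  if ws is w :: ws' then exists2 a, s * a = 0 & pspan ws' (x - a *: w) else x = 0.

Lemma pspan0 ws : pspan ws 0.
Proof. by elim: ws => //= w ws h; exists 0; rewrite ?mulr0 // scale0r subr0. Qed.

Lemma pspanD ws a x y : pspan ws x -> pspan ws y -> pspan ws (a *: x + y).
Proof.
elim: ws x y => /= [|w ws IH] x y; first by move=> -> ->; rewrite scaler0 addr0.
move=> [b hb hx] [c hc hy]; exists (a * b + c).
  by rewrite mulrDr mulrCA hb hc mulr0 addr0.
suff -> : a *: x + y - (a * b + c) *: w = a *: (x - b *: w) + (y - c *: w) by exact: IH.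
by rewrite scalerBr scalerDl scalerA opprD addrACA.
Qed.

Definition pspan_sub ws := Submodule (pspan0 ws) (@pspanD ws).

Lemma pspan_scale ws a v : s * a = 0 -> lspan ws v -> pspan ws (a *: v).
Proof.
move=> ha; elim: ws v => /= [v ->|w ws IH v [b /IH h]]; first exact: scaler0.
by exists (a * b); rewrite ?mulrA ?ha ?mul0r // -scalerA -scalerBr.
Qed.

Lemma pspan_lspan ws x : pspan ws x -> lspan ws x.
Proof. by elim: ws x => //= w ws IH x [a _ /IH h]; exists a. Qed.

(** By elimination: [u - a] is still outside p and moves [w] into p times the span of the remaining
    generators, so [w] can be substituted away from their relations. *)
Lemma nakayama ws :
  (forall w, w \in ws -> exists2 u, off u & pspan ws (u *: w)) ->
  exists2 v, off v & forall w, w \in ws -> v *: w = 0.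
Proof.
elim: ws => [|w ws IH] h; first by exists 1.
have [u hu [a ha hua]] := h w (mem_head _ _).
have hua' : pspan ws ((u - a) *: w) by rewrite scalerBl.
have ou := offB hu ha.
have [v hv vw] : exists2 v, off v & forall w, w \in ws -> v *: w = 0.
  apply: IH => w' hw'; have [|u' hu' [a' ha' h']] := h w';
    first by rewrite inE hw' orbT.
  exists ((u - a) * u'); first exact: offM.
  have -> : ((u - a) * u') *: w' =
      (u - a) *: (u' *: w' - a' *: w) + a' *: ((u - a) *: w).
    by rewrite scalerBr !scalerA [a' * _]mulrC subrK.
  by apply: pspanD => //; apply: (submodule_scale (S := pspan_sub ws)).
exists (v * (u - a)) => [|w']; first exact: offM.
rewrite inE => /orP[/eqP ->|/vw h']; last by rewrite mulrC -scalerA h' scaler0.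
rewrite -scalerA.
exact: (smem_lspan (S := ker_sub (v \*: idfun)) vw (pspan_lspan hua')).
Qed.

End Nakayama.

Lemma pmul_pspan (V : lmodType A) ws (x : V) :
  (forall v, lspan ws v) -> pmul x -> pspan ws x.
Proof. by move=> hw /(_ (pspan_sub ws)); apply=> a v ha; apply: pspan_scale. Qed.

Definition local_gen (X : lmodType A) r (e : 'I_r -> X) : Prop :=
  forall x, exists2 u, off u & exists c : 'I_r -> A, u *: x = \sum_i c i *: e i.

(** With [r] minimal, a relation having a coefficient [c i] outside p would allow [e i] to be
    eliminated after multiplication by [c i]. *)
Lemma minimal_local_gen (X : lmodType A) : finitely_generated X ->
  exists r (e : 'I_r -> X), local_gen e /\
    forall c : 'I_r -> A, \sum_i c i *: e i = 0 -> forall i, s * c i = 0.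
Proof.
move=> [k [g hg]].
have ex : exists r, `[< exists e : 'I_r -> X, local_gen e >].
  exists k; apply/asboolP; exists g => x; exists 1 => //.
case: (ex_minnP ex) => r /asboolP [e he] rmin; exists r, e; split=> // c c0 i.
apply: contrapT => hi; case: r e he rmin c c0 i hi => [|r] e he rmin c c0 i hi.
  by case: i hi.
have /rmin : `[< exists e : 'I_r -> X, local_gen e >]; last by rewrite ltnn.
apply/asboolP; exists (fun j => e (lift i j)) => x.
have [u hu [b hb]] := he x; exists (c i * u); first exact: offM.
exists (fun j => c i * b (lift i j) - b i * c (lift i j)).
have c0i : c i *: e i = - \sum_j c (lift i j) *: e (lift i j).
  by move/eqP: c0; rewrite (bigD1_ord i) //= addr_eq0 => /eqP.
rewrite -scalerA hb (bigD1_ord i) //= scalerDr scalerA mulrC -scalerA c0i.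
rewrite scalerN addrC !scaler_sumr -sumrB; apply: eq_bigr => j _.
by rewrite !scalerA scalerBl.
Qed.

(** * Descent of goodness from a syzygy to the module *)

Section Descent.
Hypothesis noethA : noetherian A.
Variables (X F W : lmodType A) (pi : {linear F -> X}) (iota : {linear W -> F}).
Hypotheses (fX : finitely_generated X) (hF : dual_basis 1 F).
Hypotheses (pi_surj : forall x, exists y, pi y = x) (iota_inj : injective iota).
Hypothesis exact : forall y, pi y = 0 <-> exists w, iota w = y.

(** Let K be the kernel of a minimal local cover E of X, so that K lies in pA^r and sK = 0. The maps
    [eps] and [theta] compare this cover with F, and goodness of W gives K = pK locally. By Nakayama
    K vanishes at p, so X is free there, and if s E(c) = 0 then [s] kills the coordinates of c. *)
Lemma good_quotient : good W -> good X.
Proof.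
move=> gW; have [r [e [he emin]]] := minimal_local_gen fX.
have lE : linear (fun c : 'rV[A]_r => \sum_i c 0 i *: e i).
  move=> a x y; rewrite scaler_sumr -big_split /=; apply: eq_bigr => i _.
  by rewrite !mxE scalerDl scalerA.
have [E EE] : exists E : {linear 'rV[A]_r -> X}, forall c, E c = \sum_i c 0 i *: e i.
  by exists (mklin lE).
have hE x : exists2 u, off u & exists c, E c = u *: x.
  have [u hu [c hc]] := he x; exists u => //; exists (\row_i c i).
  by rewrite EE hc; apply: eq_bigr => i _; rewrite mxE.
have [eps heps] : exists eps : {linear 'rV[A]_r -> F}, forall c, pi (eps c) = E c.
  have [|eps h] := tproj_lift (d := pi) (f :=
    E) (dual_basis_tproj (dual_basis1_rV _ r)).
    by move=> c; apply: pi_surj.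
  by exists eps => c; rewrite h scale1r.
have [u0 hu0 hu0E] : exists2 u, off u & forall y, exists c, E c = u *: pi y.
  have [k [g hg]] := dual_basis1_fg hF.
  have [u hu huE] : exists2 u, off u & forall i, exists c, E c = u *: pi (g i).
    apply: common_multiple => // i a b [c hc].
    by exists (b *: c); rewrite linearZ_LR hc scalerA.
  exists u => // y; have [a ->] := hg y; have /choice [c hc] := huE.
  exists (\sum_i a i *: c i);
    rewrite (linear_sum E) (linear_sum pi) scaler_sumr; apply: eq_bigr => i _.
  by rewrite (linearZ_LR E) hc (linearZ_LR pi) !scalerA mulrC.
have [theta htheta] : exists th : {linear F -> 'rV[A]_r}, forall y, E (th y) = u0 *: pi y.
  have [|th h] := tproj_lift (d := E) (f := u0 \*: pi) (dual_basis_tproj hF).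
    by move=> y; apply: hu0E.
  by exists th => y; rewrite h scale1r.
pose K := subm (ker_sub E).
have thK w : ker_sub E ((theta \o iota) w).
  by rewrite /= htheta (_ : pi (iota w) = 0) ?scaler0 //; apply/exact; exists w.
have DK c : ker_sub E (((theta \o eps) \- (u0 \*: idfun)) c).
  by rewrite /= linearB linearZ_LR /= htheta heps subrr.
have Kp (w : K) : pmul (val w).
  rewrite [val w]row_sum_delta; apply: (smem_bigsum (S := pmul_sub _)) => i.
  by apply: pmul_scale; apply: (emin (fun i => val w 0 i)); rewrite -EE;
    exact: (submP w).
have gK (w : K) : exists2 u, off u & pmul (u *: w).
  have [y hy] : exists y, iota y = eps (val w).
    by apply/exact; rewrite heps; apply: (submP w).
  have sw : s *: val w = 0.
    apply: (Kp w (ker_sub (s \*: idfun))) => a v ha /=.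
    by rewrite scalerA ha scale0r.
  have sy : s *: y = 0 by apply: iota_inj;
    rewrite linearZ_LR hy -linearZ_LR sw !raddf0.
  have [u hu py] := gW y sy; exists (u * u0); first exact: offM.
  (* Both terms lie in pK: the first because [u *: y] is in pW, the second because [val w] is in
     pA^r and [corestrict DK] maps A^r into K. *)
  have -> : (u * u0) *: w = corestrict thK (u *: y) - u *: corestrict DK (val w).
    apply/val_inj;
      rewrite /= linearZ_LR /= linearZ_LR /= hy -scalerBr subKr scalerA //.
  apply: (submodule_sub (S := pmul_sub K)); first exact: pmul_lin.
  apply: (submodule_scale (S := pmul_sub K)); apply: pmul_lin; exact: Kp.
have /fg_lspan [ws hws] : finitely_generated K.
  apply: (fg_inj noethA (f := subm_lin (ker_sub E))); first exact: val_inj.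
  exact/dual_basis1_fg/dual_basis1_rV.
have [w _|v hv vK] := @nakayama _ ws.
  by have [u hu h] := gK w; exists u => //; apply: pmul_pspan.
move=> x sx; have [u hu [c hc]] := hE x; exists u => //.
have scK : ker_sub E (s *: c).
  by rewrite /= linearZ_LR hc scalerA mulrC -scalerA sx scaler0.
have vsc : v *: subm_in scK = 0.
  exact: (smem_lspan (S := ker_sub (v \*: idfun)) vK (hws _)).
rewrite -hc EE; apply: (smem_bigsum (S := pmul_sub X)) => i; apply: pmul_scale.
apply: (off_mul_eq0 hv); have /(congr1 val) /rowP /(_ i) := vsc.
by rewrite /= !mxE mulrCA.
Qed.

End Descent.

(** * Goodness of syzygies inside a resolution *)

Definition pdiff (M : lmodType A) (P : resolution M) n (z : P n) : Prop :=
  exists x y, pmul x /\ z = x + rdiff P n y.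

Lemma pdiff0 (M : lmodType A) (P : resolution M) n : pdiff (0 : P n).
Proof. by exists 0, 0; rewrite raddf0 addr0; split=> //; apply: pmul0. Qed.

Lemma pdiffD (M : lmodType A) (P : resolution M) n a (z w : P n) :
  pdiff z -> pdiff w -> pdiff (a *: z + w).
Proof.
move=> [x [y [hx ->]]] [x' [y' [hx' ->]]]; exists (a *: x + x'), (a *: y + y').
by split; [apply: pmulD | rewrite linearP scalerDr addrACA].
Qed.

Definition pdiff_sub (M : lmodType A) (P : resolution M) n :=
  Submodule (pdiff0 P n) (@pdiffD M P n).

Lemma pmul_pdiff (M : lmodType A) (P : resolution M) n (z : P n) :
  pmul z -> pdiff z.
Proof. by exists z, 0; rewrite raddf0 addr0. Qed.

Lemma diff_pdiff (M : lmodType A) (P : resolution M) n y : pdiff (rdiff P n y).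
Proof. by exists 0, y; rewrite add0r; split=> //; apply: pmul0. Qed.

(* The [n]-th syzygy, i.e. the cokernel of [rdiff P n], is good. *)
Definition good_coker (M : lmodType A) (P : resolution M) n : Prop :=
  forall x y, s *: x = rdiff P n y -> exists2 u, off u & pdiff (u *: x).

Lemma good_of_coker : noetherian A ->
  forall n (M : lmodType A) (P : resolution M), finitely_generated M ->
    (forall i, dual_basis 1 (P i)) -> good_coker P n -> good M.
Proof.
move=> noethA; elim=> [|n IHn] M P fM hP gP.
  move=> m sm; have [x hx] := raug_surj P m.
  have [y hy] : exists y, rdiff P 0 y = s *: x.
    by apply/(rexact0 P); rewrite linearZ_LR hx.
  have [u hu [z [w [hz uxE]]]] := gP x y (esym hy); exists u => //.
  rewrite -hx -linearZ_LR uxE linearD.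
  have -> : raug P (rdiff P 0 w) = 0 by apply/(rexact0 P); exists w.
  by rewrite addr0; apply: pmul_lin.
have fI : finitely_generated (subm (img_sub (rdiff P 0))).
  exact: (fg_surj (@shift_surj _ _ P) (dual_basis1_fg (hP 1%N))).
have gI := IHn _ (shift P) fI (fun i => hP i.+1) gP.
apply: (@good_quotient noethA M (P 0%N) _ (raug P) (subm_lin _) fM (hP 0%N) (raug_surj P) _ _ gI).
  exact: val_inj.
move=> y; rewrite (rexact0 P); split=> [h|[w <-]]; last exact: (submP w).
by exists (@subm_in _ _ (img_sub (rdiff P 0)) y h).
Qed.

(** The homotopy formula splits a multiple of x into be(al x), eta(x) and a boundary. Goodness for
    [Q] handles al(x). In positive degree eta factors through d x, which is killed by [s] and so
    lies locally in p times the previous term. *)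
Lemma good_coker_retract (M N : lmodType A) (P : resolution M) (Q : resolution N)
    t (p : {linear M -> N}) (q : {linear N -> M}) n :
  off t -> (forall i, dual_basis t (P i)) -> (forall i, dual_basis t (Q i)) ->
  (forall x, q (p x) = t *: x) -> good_coker Q n -> good_coker P n.
Proof.
move=> ht hP hQ qp gQ x y sx.
have [al [al' [be [be' [eta [h [hal hbe heta hh]]]]]]] :=
  @comparison _ _ (central_scalar_com t) _ _ P Q
    (fun i => dual_basis_tproj (hP i)) (fun i => dual_basis_tproj (hQ i)) p q qp n.
have [|u hu [z [w [hz uE]]]] := gQ (al x) (al' y).
  by rewrite -linearZ_LR sx hal.
have [u' hu' etaE] : exists2 u, off u & pmul (u *: eta x).
  case: n P Q hP hQ gQ x y sx al al' be be' eta h hal hbe heta hh u hu z w hz uE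
    => [|n] P Q hP hQ gQ x y sx al al' be be' eta h hal hbe heta hh u hu z w hz uE.
    by exists 1 => //; rewrite (heta x) scaler0; apply: pmul0.
  have [k hk] := heta.
  have [|u' hu' hd] := dual_basis_good ht (hP n) (v := rdiff P n x).
    by rewrite -linearZ_LR sx rdiffK.
  by exists u' => //; rewrite hk -linearZ_LR; apply: pmul_lin.
have offX k : off (t ^+ k) by elim: k => // k IHk; rewrite exprS; apply: offM.
exists (u' * u * t ^+ (6 + n * 2)); first exact: (offM (offM hu' hu) (offX _)).
rewrite -scalerA hh !scalerDr.
have S := @submodule_scale _ _ (pdiff_sub P n);
  have D := @submodule_add _ _ (pdiff_sub P n).
apply: (D _ _); [apply: (D _ _) | by apply: (S _ _); apply: diff_pdiff].
  rewrite -scalerA. apply: (S _ _); rewrite -linearZ_LR uE linearD -hbe.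
  by apply: (D _ _); [apply/pmul_pdiff/pmul_lin | apply: diff_pdiff].
by rewrite mulrC -scalerA; apply: (S _ _); apply: pmul_pdiff.
Qed.

End AssociatedPrime.
(** * Coinduced modules *)

Lemma ffun_fg (R : pzRingType) (k : nat) (X : lmodType R) :
  finitely_generated X -> finitely_generated {ffun 'I_k -> X}.
Proof.
move=> [r [e he]]; apply/fg_lspan.
pose b (ij : 'I_k * 'I_r) : {ffun 'I_k -> X} := [ffun l => e ij.2 *+ (l == ij.1)].
exists [seq b ij | ij <- enum {: 'I_k * 'I_r}] => x.
have /choice [c hc] : forall i, exists c : 'I_r -> R, x i = \sum_j c j *: e j.
  by move=> i; apply: he.
have -> : x = \sum_i \sum_j c i j *: b (i, j).
  apply/ffunP => l;
    rewrite hc sum_ffunE (bigD1 l) //= [X in _ + X]big1 => [|i /negPf il].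
    by rewrite addr0 sum_ffunE; apply: eq_bigr => j _; rewrite !ffunE eqxx.
  by rewrite sum_ffunE big1 // => j _; rewrite !ffunE eq_sym il scaler0.
set T := [seq _ | _ <- _].
apply: (smem_bigsum (S := lspan_sub T)) => i.
apply: (smem_bigsum (S := lspan_sub T)) => j; rewrite -[_ *: _]addr0.
apply: smemD; last exact: smem0.
by apply: mem_lspan; apply: map_f; rewrite mem_enum.
Qed.

Section Coinduced.
Variables (A : comPzRingType) (L : pzRingType) (rho : {rmorphism A -> L}).

(* [Hom_A(L, X)], a right [L]-module for [(f l) l' = f (l l')]. *)
Definition coind (X : lmodType A) : Type := linhom (regmod rho) X.

Variable X : lmodType A.

HB.instance Definition _ := GRing.Zmodule.copy (coind X) (linhom (regmod rho) X).

Lemma lmul_linear (l : L) : linear (fun x : regmod rho => l * (x : L) : regmod rho).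
Proof.
move=> a x y; rewrite !restrE.
exact: (etrans (mulrDr l _ _) (congr1 (fun z => z + l * (y : L)) (mulrA l (x : L) (rho a)))).
Qed.

Definition lmul_lin (l : L) : {linear regmod rho -> regmod rho} :=
  mklin (lmul_linear l).

Definition coind_scale (l : L^c) (f : coind X) : coind X :=
  (f : {linear regmod rho -> X}) \o lmul_lin l.

Lemma coind_scaleA l l' f : coind_scale l (coind_scale l' f) = coind_scale (l * l') f.
Proof. by apply/homP => x;
  apply: (congr1 (f : linhom _ _) (mulrA (l' : L) (l : L) (x : L))). Qed.

Lemma coind_scale1 : left_id 1 coind_scale.
Proof. by move=> f; apply/homP => x;
  apply: (congr1 (f : linhom _ _) (mul1r (x : L))). Qed.

Lemma coind_scaleDr : right_distributive coind_scale +%R.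
Proof. by move=> l f g; apply/homP. Qed.

Lemma coind_scaleDl f : {morph coind_scale^~ f : l l' / l + l'}.
Proof.
move=> l l'; apply/homP => x.
rewrite -[RHS](raddfD (f : {linear regmod rho -> X})).
exact: (congr1 (f : linhom _ _) (mulrDl (l : L) (l' : L) (x : L))).
Qed.

HB.instance Definition _ := GRing.Zmodule_isLmodule.Build L^c (coind X)
  coind_scaleA coind_scale1 coind_scaleDr coind_scaleDl.

Hypothesis rhoC : forall a x, rho a * x = x * rho a.

Lemma coind_restrE a (f : restr rho (coind X)) (x : regmod rho) :
  (a *: f : linhom _ _) x = a *: (f : linhom _ _) x.
Proof.
rewrite -[RHS](linearZ_LR (f : {linear regmod rho -> X})).
exact: (congr1 (f : linhom _ _) (rhoC a (x : L))).
Qed.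

Lemma coind_fg : noetherian A -> finitely_generated (regmod rho) ->
  finitely_generated X -> finitely_generated (coind X).
Proof.
move=> noethA [k [l hl]] fX; apply: (fg_restr (rho := rho)).
have lev : linear (fun f : restr rho (coind X) =>
    [ffun i => (f : linhom _ _) (l i)] : {ffun 'I_k -> X}).
  move=> a f g; apply/ffunP => i; rewrite !ffunE.
  by rewrite -coind_restrE.
apply: (fg_inj noethA (f := mklin lev)); last exact: ffun_fg.
move=> f g /ffunP fg; apply/homP => x; have [c ->] := hl x.
rewrite !linear_sum; apply: eq_bigr => i _; rewrite !linearZ_LR; congr (_ *: _).
by have := fg i; rewrite !ffunE.
Qed.

Variables (g : {linear regmod rho -> A^o}) (m : regmod rho).

Lemma to_coind_linear (x : X) : linear (fun l => (g l : A) *: x).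
Proof. by move=> a l l'; rewrite linearP scalerDl /= scalerA. Qed.

Lemma to_coind_linear2 :
  linear (fun x => (mklin (to_coind_linear x) : linhom _ _) : restr rho (coind X)).
Proof.
move=> a x y; apply/homP => l.
transitivity (a *: ((g l : A) *: x) + (g l : A) *: y).
  by rewrite /= scalerDr !scalerA mulrC.
by rewrite -[a *: _](coind_restrE a (mklin (to_coind_linear x) : linhom _ _) l).
Qed.

Definition to_coind : {linear X -> restr rho (coind X)} := mklin to_coind_linear2.

Lemma from_coind_linear : linear (fun f : restr rho (coind X) => (f : linhom _ _) m).
Proof. by move=> a f f'; rewrite -coind_restrE. Qed.

Definition from_coind : {linear restr rho (coind X) -> X} :=
  mklin from_coind_linear.

Lemma to_coindK x : from_coind (to_coind x) = (g m : A) *: x.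
Proof. by []. Qed.

End Coinduced.
(** * Central elements integral over the base ring *)

Section Maximal.
Variable A : comPzRingType.
Hypothesis noethA : noetherian A.

Lemma noetherian_maximal (F : set (set A)) :
  (forall I, F I -> is_ideal I) -> (exists I, F I) ->
  exists2 I, F I & forall J, F J -> (I `<=` J)%classic -> (J `<=` I)%classic.
Proof.
move=> Fid [I0 FI0]; apply: contrapT => nomax.
have step (I : {I | F I}) : exists J : {I | F I},
    (sval I `<=` sval J)%classic /\ ~ (sval J `<=` sval I)%classic.
  case: I => I FI /=; apply: contrapT => noJ; apply: nomax; exists I => // J FJ IJ.
  by apply: contrapT => JI; apply: noJ; exists (exist _ J FJ).
have [next nextP] := choice step.
pose I n := sval (iter n next (exist _ I0 FI0)).
have Iid n : is_ideal (I n) by apply/Fid/(proj2_sig (iter n next _)).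
have Imono n k : (I n `<=` I (k + n)%N)%classic.
  by elim: k => // k IHk x /IHk hx; apply: (proj1 (nextP (iter (k + n) next _))).
pose U := [set x | exists n, I n x]%classic.
have Uid : is_ideal U.
  split=> [|x y [n hx] [k hy]|a x [n hx]].
  - by exists 0%N; have [] := Iid 0%N.
  - exists (n + k)%N; have [_ h _] := Iid (n + k)%N; apply: h; last exact: Imono.
    by rewrite addnC; apply: Imono.
  - by exists n; have [_ _] := Iid n; apply.
have [r [e Ue]] := noethA Uid.
have /choice [n hn] : forall i, exists n, I n (e i).
  move=> i; suff : U (e i) by [].
  rewrite Ue; exists (fun j => (j == i)%:R); rewrite (bigD1 i) //= eqxx mul1r.
  by rewrite big1 ?addr0 // => j /negPf ->; rewrite mul0r.
pose N := (\sum_i n i)%N.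
have [_] := nextP (iter N next (exist _ I0 FI0)); apply=> x hx.
have : U x by exists N.+1.
rewrite Ue => -[c ->]; rewrite -/(I N).
have [h0 hD hM] := Iid N.
apply: (big_ind (I N)) => // i _; apply: hM.
by rewrite /N (bigD1 i) //= addnC; apply: Imono.
Qed.

(** An annihilator that is maximal among those of the nonzero multiples of [y] is prime. *)
Lemma associated_prime (y : A) : y <> 0 ->
  exists z, [/\ z * y <> 0, off (z * y) 1 &
    forall u v, off (z * y) u -> off (z * y) v -> off (z * y) (u * v)].
Proof.
move=> y0.
pose F := [set I : set A | exists z, z * y <> 0 /\ I = [set a | z * y * a = 0]]%classic.
have [_ [z [_ ->]]||_ [z [zy ->]] max] := @noetherian_maximal F.
- split=> [|a b ha hb|a b hb] /=; first exact: mulr0.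
    by rewrite mulrDr ha hb addr0.
  by rewrite mulrCA hb mulr0.
- by exists [set a | 1 * y * a = 0]%classic; exists 1; rewrite mul1r.
exists z; split=> //; first by rewrite /off mulr1.
move=> u v hu hv huv; apply: hu.
have h := max [set a | (v * z) * y * a = 0]%classic; apply: h.
- by exists (v * z); split=> //; rewrite -mulrA mulrC.
- by move=> a /= ha; rewrite -!mulrA (mulrA z) ha mulr0.
- by rewrite /= -huv; ring.
Qed.

End Maximal.

Section CentralIntegral.
Variables (A : comPzRingType) (L : pzRingType) (rho : {rmorphism A -> L}).
Hypothesis noethA : noetherian A.
Hypothesis rhoC : forall a x, rho a * x = x * rho a.
Hypothesis fL : finitely_generated (regmod rho).
Local Notation RL := (regmod rho).

Variable c : L.
Hypothesis cC : forall x, c * x = x * c.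
Hypothesis c_nzd : forall x, (forall y, x * y = y * x) -> c * x = 0 -> x = 0.

Definition pol (a : nat -> A) k : RL := \sum_(i < k) a i *: (c ^+ i : RL).

Lemma regmodE a (x : RL) : a *: x = (x : L) * rho a.
Proof. by []. Qed.

Lemma pol_recl a k :
  pol a k.+1 = a 0%N *: ((1 : L) : RL) + (c * (pol (fun i => a i.+1) k : L) : L).
Proof.
rewrite /pol big_ord_recl expr0; congr (_ + _).
rewrite -[RHS]/(lmul_lin rho c _) linear_sum; apply: eq_bigr => i _.
by rewrite linearZ_LR /bump /= exprS.
Qed.

Lemma pol_central a k (y : L) : (pol a k : L) * y = y * (pol a k : L).
Proof.
elim: k a => [|k IHk] a; first by rewrite /pol big_ord0 mul0r mulr0.
rewrite pol_recl mulrDl mulrDr; congr (_ + _); first by rewrite regmodE mul1r rhoC.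
by rewrite -mulrA IHk !mulrA cC.
Qed.

Lemma scale_pol_central s a k (y : L) :
  (s *: pol a k : L) * y = y * (s *: pol a k : L).
Proof.
rewrite regmodE -[LHS]mulrA rhoC [RHS]mulrA -pol_central; exact: mulrA.
Qed.

(** The union of the spans of 1, c, ..., c^{k-1} is finitely generated, so it is reached at some
    stage K, and c^K is a combination of lower powers. *)
Lemma central_integral : exists k (a : nat -> A), a k = 1 /\ pol a k.+1 = 0.
Proof.
pose pows k := [seq (c ^+ i : RL) | i <- iota 0 k].
have mono k j x : lspan (pows k) x -> lspan (pows (k + j)) x.
  apply: (smem_lspan (S := lspan_sub _)) => _ /mapP[i hi ->].
  apply/mem_lspan/map_f; move: hi; rewrite !mem_iota !add0n => /andP[-> h] /=.
  exact: ltn_addr.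
have S0 : exists k, lspan (pows k) 0 by exists 0%N.
have SD a x y : (exists k, lspan (pows k) x) -> (exists k, lspan (pows k) y) ->
    exists k, lspan (pows k) (a *: x + y).
  move=> [k hx] [j hy]; exists (k + j)%N; apply: lspanP; first exact: mono.
  by rewrite addnC; apply: mono.
have [s hs] := (fg_lspan RL).1 fL.
have [t [tS ht]] := noetherian_submodule noethA (S :=
  Submodule S0 SD) (fun x _ => hs x).
have [K hK] : exists K, forall v, v \in t -> lspan (pows K) v.
  elim: t tS {ht} => [_|v t IHt tS]; first by exists 0%N.
  have [|K hK] := IHt; first by move=> w hw; apply: tS; rewrite inE hw orbT.
  have [j hj] := tS v (mem_head _ _); exists (K + j)%N => w.
  rewrite inE => /orP[/eqP ->|/hK h]; last exact: mono.
  by rewrite addnC; apply: mono.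
have : lspan (pows K) (c ^+ K : RL).
  apply: (smem_lspan (S := lspan_sub _) hK); apply: ht; exists K.+1.
  by apply/mem_lspan/map_f; rewrite mem_iota /= add0n.
move=> /lspan_sum; rewrite size_map size_iota => -[a ha].
exists K, (fun i => if i == K then 1 else - oapp a 0 (insub i : option 'I_K)).
rewrite eqxx; split=> //;
  rewrite /pol big_ord_recr /= eqxx scale1r ha -big_split /=.
apply: big1 => i _; rewrite ltn_eqF // insubT //= => hi.
rewrite (nth_map 0%N) ?size_iota // nth_iota // add0n scaleNr.
by rewrite (_ : Sub _ _ = i) ?addNr //; apply/val_inj.
Qed.

(** As long as s a_0 = 0, the factor [c] cancels and the equation gets shorter. The leading
    coefficient 1, not killed by [s], stops the process. *)
Lemma strip_polynomial s : off s 1 ->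
  exists k (a : nat -> A), off s (a 0%N) /\ s *: pol a k.+1 = 0.
Proof.
move=> hs; have [k [a [ak hk]]] := central_integral.
have {hk} : s *: pol a k.+1 = 0 by rewrite hk scaler0.
elim: k a ak => [|k IHk] a ak; first by move=> h; exists 0%N, a; rewrite ak.
have [ha h|ha h] := pselect (off s (a 0%N)); first by exists k.+1, a.
apply: (IHk (fun i => a i.+1) ak).
apply: c_nzd => [y|]; first exact: scale_pol_central.
move: h; rewrite pol_recl scalerDr scalerA; move/contrapT: ha => ->.
by rewrite scale0r add0r -[X in X = 0 -> _](linearZ_LR (lmul_lin rho c)).
Qed.

(** The equation shows that s a_0 is [c] times a central element, so [s] kills it. Multiplying by
    [s] thus removes the constant term and [c] cancels: the degree drops while [s] becomes s^2. *)
Lemma strip_nilpotent s k (a : nat -> A) :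
  (forall x, rho x = 0 -> x = 0) ->
  (forall x z, (forall y, z * y = y * z) -> rho x = c * z -> s * x = 0) ->
  a k = 1 -> s *: pol a k.+1 = 0 -> exists m, s ^+ m = 0.
Proof.
move=> faith; elim: k s a => [|k IHk] s a hs ak.
  rewrite pol_recl /pol big_ord0 mulr0 addr0 ak scale1r regmodE mul1r => /faith s0.
  by exists 1%N.
rewrite pol_recl scalerDr scalerA => h.
set q := pol _ _ in h.
have sa : s * (s * a 0%N) = 0.
  apply: (hs _ (- ((q : L) * rho s))) => [y|].
    rewrite mulNr mulrN; congr (- _).
    exact: (scale_pol_central s (fun i => a i.+1) k.+1 y).
  have := h; rewrite !regmodE mul1r => /eqP; rewrite addr_eq0 => /eqP ->.
  by rewrite mulrN mulrA.
have [||m hm] := IHk (s ^+ 2) (fun i => a i.+1) _ ak.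
- by move=> x z hz /(hs _ _ hz) sx; rewrite expr2 -mulrA sx mulr0.
- apply: c_nzd => [y|]; first exact: scale_pol_central.
  have := congr1 (fun x => s *: x) h;
    rewrite scalerDr !scalerA sa scale0r add0r scaler0.
  move=> E; rewrite -[LHS]/(lmul_lin rho c (s ^+ 2 *: q)) linearZ_LR expr2.
  exact: E.
by exists (2 * m)%N; rewrite exprM.
Qed.

(* Among the [x] with [rho x] in [c L^c], choose [d] with minimal annihilator. *)
(* If [s d = 0], then [s] kills all these [x], as [d + s x] would otherwise    *)
(* have a smaller annihilator; the equation of [c] then makes [s] nilpotent.   *)
Lemma central_nonzerodivisor : reduced A -> (forall x, rho x = 0 -> x = 0) ->
  exists2 x, nonzerodivisor x &
    exists2 z, (forall y, z * y = y * z) & rho x = c * z.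
Proof.
move=> redA faith.
have sq0 (x : A) : x * x = 0 -> x = 0 by rewrite -expr2; apply: redA.
pose I (x : A) := exists2 z, (forall y, z * y = y * z) & rho x = c * z.
have I0 : I 0 by exists 0; rewrite ?mulr0 ?rmorph0 // => y; rewrite mul0r mulr0.
(* The double annihilator of [d]: it grows as the annihilator of [d] shrinks, so a maximal one gives
   a minimal annihilator. *)
pose bi (d : A) := [set x | forall z, z * d = 0 -> x * z = 0]%classic.
pose F := [set J | exists d, I d /\ J = bi d]%classic.
have [_ [d [_ ->]]||_ [d [Id ->]] max] := @noetherian_maximal _ noethA F.
- split=> [z _|x y hx hy z hz|a x hx z hz]; first exact: mul0r.
    by rewrite mulrDl hx // hy // addr0.
  by rewrite -mulrA hx // mulr0.
- by exists (bi 0), 0.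
exists d => // s; rewrite mulrC => sd.
have hs x : I x -> s * x = 0.
  move=> Ix; pose d' := d + s * x.
  have Id' : I d'.
    have [z zC hz] := Id; have [w wC hw] := Ix.
    exists (z + w * rho s) => [y|].
      by rewrite mulrDl mulrDr zC -mulrA rhoC !mulrA wC.
    by rewrite rmorphD rmorphM hz hw mulrDr rhoC mulrA.
  have key z : z * d' = 0 -> z * (s * x) = 0 /\ z * d = 0.
    rewrite mulrDr => h.
    have zsx : z * (s * x) = 0.
      apply: sq0; transitivity (z * s * x * ((z * d + z * (s * x)) - z * d)).
        by ring.
      by rewrite h; transitivity (- (z * x * z * (s * d)));
        [ring | rewrite sd; ring].
    by split=> //; move: h; rewrite zsx addr0.
  have sub : (bi d `<=` bi d')%classic by move=> w hw z /key[_ /hw].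
  have := max (bi d') (ex_intro _ d' (conj Id' erefl)) sub (s * x).
  have mem : bi d' (s * x) by move=> z /key[zsx _]; rewrite mulrC.
  move=> /(_ mem s sd) h; apply: sq0.
  by transitivity (s * x * s * x); [ring | rewrite h mul0r].
have [k [a [ak hk]]] := central_integral.
have [||m /redA //] := strip_nilpotent faith _ ak (_ : s *: pol a k.+1 = 0).
  by move=> x z hz hx; apply: hs; exists z.
by rewrite hk scaler0.
Qed.

End CentralIntegral.
(** * Comparison of a finite algebra with its base ring *)

Lemma dual_basisZ (A : comPzRingType) (V : lmodType A) (t : A) :
  dual_basis 1 V -> dual_basis t V.
Proof.
move=> [k [h [y hy]]]; exists k, (fun i => t \*: h i), y => x.
rewrite -{1}[x]scale1r hy scaler_sumr; apply: eq_bigr => i _.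
by rewrite scalerA.
Qed.

Section FiniteAlgebra.
Variables (A : comPzRingType) (L : pzRingType) (rho : {rmorphism A -> L}).
Hypothesis noethA : noetherian A.
Hypothesis rhoC : forall a x, rho a * x = x * rho a.
Hypothesis fL : finitely_generated (regmod rho).

Lemma killed_restr_mul (M : lmodType L^c) (P : resolution M) n
    (c z : ring_center L) a :
  rho a = center_val c * center_val z -> killed P n (center_val c : L^c) ->
  killed (restr_resolution rho P) n a.
Proof.
move=> acz [r hr].
exists (restr_lin rho (scale_lin (center_val_central z) r)) => x.
rewrite /= linearZ_LR /= hr scalerA restrE acz; exact: erefl.
Qed.

(** If s x = d y, then [s] kills c x - d r(x). So c x, and with it every c^i x for i > 0, lies
    locally in pP + im d. Since [s] kills the polynomial in [c], that polynomial lies locally in pL,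
    and only the term a_0 x is left. *)
Lemma good_coker_restr s (c : ring_center L) k (a : nat -> A) t n
    (M : lmodType L^c) (P : resolution M) :
  off s 1 -> (forall u v, off s u -> off s v -> off s (u * v)) ->
  off s (a 0%N) -> s *: pol rho c a k.+1 = 0 ->
  off s t -> dual_basis t (regmod rho) -> (forall i, dual_basis 1 (P i)) ->
  killed P n (center_val c : L^c) -> good_coker s (restr_resolution rho P) n.
Proof.
move=> s1 sM a0 sa ht bL hP [r hr] x y sx.
set P' := restr_resolution rho P.
have [u hu pu] := dual_basis_good ht bL sa.
pose gam : {linear P' n -> P' n} :=
  restr_lin rho (scale_lin (center_val_central c) idfun).
pose rr : {linear P' n -> P' n.+1} := restr_lin rho r.
have gamd z : gam (rdiff P' n z) = rdiff P' n (restr_lin rho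
    (scale_lin (center_val_central c) idfun) z).
  by rewrite /gam /= linearZ_LR.
have drd z : rdiff P' n (rr (rdiff P' n z)) = gam (rdiff P' n z) by apply: hr.
have [|u1 hu1 pu1] := dual_basis_good ht (restr_dual_basis bL (hP n))
    (v := (gam \- (rdiff P' n \o rr)) x).
  by rewrite -linearZ_LR sx /= drd subrr.
have base : pdiff_sub s P' n (u1 *: gam x).
  have -> : u1 *: gam x = u1 *: (gam \- (rdiff P' n \o rr)) x + rdiff P' n (u1 *: rr x).
    by rewrite linearZ_LR -scalerDr /= subrK.
  by exists (u1 *: (gam \- (rdiff P' n \o rr)) x), (u1 *: rr x).
have gamS z : pdiff_sub s P' n z -> pdiff_sub s P' n (gam z).
  move=> [z1 [w [hz ->]]]; rewrite linearD gamd.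
  apply: (submodule_add (S := pdiff_sub s P' n)); last exact: diff_pdiff.
  by apply/pmul_pdiff/pmul_lin.
pose o : {linear regmod rho -> P' n} := orbit_lin rho (x : P n).
have oS i : o ((center_val c : L) ^+ i.+1) = gam (o ((center_val c : L) ^+ i)).
  rewrite /o /gam /= scalerA exprSr. exact: erefl.
have powS i : pdiff_sub s P' n (u1 *: o ((center_val c : L) ^+ i.+1)).
  elim: i => [|i IHi]; last by rewrite oS -linearZ_LR; apply: gamS.
  by rewrite oS expr0 /o /= scale1r.
exists (u1 * u * a 0%N); first exact: (sM _ _ (sM _ _ hu1 hu) a0).
have oE : o (pol rho c a k.+1) = \sum_(i < k.+1) a i *: o ((center_val c : L) ^+ i).
  by rewrite /pol linear_sum; apply: eq_bigr => i _; rewrite linearZ_LR.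
have E : (u1 * u * a 0%N) *: (x : P' n) = u1 *: o (u *: pol rho c a k.+1)
    - u *: \sum_(i < k) a i.+1 *: (u1 *: o ((center_val c : L) ^+ i.+1)).
  rewrite (linearZ_LR o) oE big_ord_recl !scalerDr !scalerA expr0.
  have -> : o 1 = x by rewrite /o /= scale1r.
  rewrite !scaler_sumr [u1 * u]mulrC.
  rewrite -addrA -sumrB big1 ?addr0 // => i _.
  by rewrite /bump /= !scalerA; apply/eqP; rewrite subr_eq0; apply/eqP;
    congr (_ *: _); ring.
rewrite E; apply: (submodule_sub (S := pdiff_sub s P' n)).
  apply: (submodule_scale (S := pdiff_sub s P' n)).
  exact/pmul_pdiff/pmul_lin.
apply: (submodule_scale (S := pdiff_sub s P' n)).
apply: (smem_bigsum (S := pdiff_sub s P' n)) => i.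
exact: (submodule_scale (S := pdiff_sub s P' n)).
Qed.

End FiniteAlgebra.

(** * Reducedness of the base and transfer of annihilators *)

Section BaseRing.
Variables (A : comPzRingType) (L : pzRingType) (rho : {rmorphism A -> L}).
Hypothesis noethA : noetherian A.
Hypothesis rhoC : forall a x, rho a * x = x * rho a.
Hypothesis fL : finitely_generated (regmod rho).
Variables (t : A) (g : {linear regmod rho -> A^o}) (m : regmod rho).
Hypotheses (bL : dual_basis t (regmod rho)) (gm : g m = t).

Lemma reduced_base n (c : ring_center L) :
  nonzerodivisor t -> ca n.+1 c -> nonzerodivisor c -> reduced A.
Proof.
move=> t_nzd hc c_nzd.
suff sq0 (y : A) : y * y = 0 -> y = 0.
  move=> x k xk; have {xk} : x ^+ (2 ^ k) = 0.
    by rewrite -(subnK (ltnW (ltn_expl k (ltnSn 1)))) exprD xk mulr0.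
  by elim: k => [|k IHk]; rewrite ?expr1 // expnSr exprM => /sq0/IHk.
move=> yy; apply: contrapT => /(associated_prime noethA)[z [sn0 s1 sM]].
set s := z * y in sn0 s1 sM.
have ss : s * s = 0 by rewrite /s mulrACA yy mulr0.
have cC : forall x, center_val c * x = x * center_val c by apply/centralP/(valP c).
have c_nzd' x := @nonzerodivisor_center L c x c_nzd.
have [k [a [a0 sa]]] := strip_polynomial noethA rhoC fL cC c_nzd' s1.
have st := nonzerodivisor_off s1 t_nzd.
pose sl : {linear A^o -> A^o} := s \*: idfun.
(* This is the ideal sA: p annihilates it, and so does [s] since s^2 = 0, while goodness would make
   its generator vanish at p. *)
pose X := subm (img_sub sl).
have hsl x : img_sub sl (sl x) by exists x.
have fX : finitely_generated X.
  apply: (fg_surj (f := corestrict hsl)) => [v|].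
    by have [x hx] := submP v; exists x; apply/val_inj.
  by exists 1%N, (fun=> 1 : A^o) => v; exists (fun=> v);
    rewrite big_ord1 /GRing.scale /= mulr1.
have fM := coind_fg rhoC noethA fL fX.
have [Q hQ] := free_resolution (fun U V f => fg_inj_restr (f := f) noethA fL) fM.
have [P hP] := free_resolution (fun U V f => fg_inj (f := f) noethA) fX.
have gQ := good_coker_restr s1 sM a0 sa st bL hQ (ca_killed hc fM hQ).
have gP : good_coker s P n.
  have qp x : from_coind X rhoC m (to_coind X rhoC g x) = t *: x by rewrite to_coindK gm.
  exact: (good_coker_retract (P := P) (Q := restr_resolution rho Q) s1 sM st
    (fun i => dual_basisZ t (hP i)) (fun i => restr_dual_basis bL (hQ i)) qp gQ).
have gX := good_of_coker s1 sM noethA fX hP gP.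
pose v : X := subm_in (hsl 1).
have [|u hu puv] := gX v; first by apply/val_inj; rewrite /= /GRing.scale /= mulr1.
have uv0 : u *: v = 0.
  apply: (puv (ker_sub idfun)) => b w sb /=; apply/val_inj => /=.
  have [x <-] := submP w; rewrite /= /GRing.scale /= mulrA [b * s]mulrC sb mul0r //.
by apply: hu; have /(congr1 val) := uv0; rewrite /= /GRing.scale /= mulr1 mulrC.
Qed.

Section Transfer.
Variables (L' : pzRingType) (rho' : {rmorphism A -> L'}).
Hypothesis rhoC' : forall a x, rho' a * x = x * rho' a.
Hypothesis fL' : finitely_generated (regmod rho').
Hypothesis bL' : dual_basis t (regmod rho').
Variables (k : nat) (p q : 'I_k -> L') (C : L' -> 'I_k -> 'I_k -> A) (d e : A).
Hypothesis hq : forall s i, rho' d * (s * q i) = \sum_j rho' (C s i j) * q j.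
Hypothesis hp : forall s j, rho' d * (p j * s) = \sum_i rho' (C s i j) * p i.
Hypothesis hqp : \sum_i q i * p i = rho' e.

(** The factors: [a] is the multiple of [c] that comes from A, the power of [t] pays for the
    comparison with the coinduced module, and [d * e] pays for averaging over [L']. *)
Lemma ca_transfer n (c z : ring_center L) a (c' : ring_center L') :
  rho a = center_val c * center_val z -> ca n.+1 c ->
  center_val c' = rho' (d * e * (a * t ^+ (6 + n * 2))) -> ca n.+1 c'.
Proof.
move=> ac hc c'E; apply: ca_intro => [U V f|X P fX hP].
  exact: (fg_inj_restr noethA fL').
rewrite c'E; apply: (killed_separable rhoC' hq hp hqp).
have fM : finitely_generated (coind rho (restr rho' X)).
  exact/(coind_fg rhoC noethA fL)/restr_fg.
have [Q hQ] := free_resolution (fun U V f => fg_inj_restr (f := f) noethA fL) fM.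
have hk := killed_restr_mul ac (ca_killed hc fM hQ).
apply: (transfer_killed bL bL' hQ hP (p := to_coind _ rhoC g) (q := from_coind _ rhoC m) _ hk).
by move=> x; rewrite to_coindK gm.
Qed.

End Transfer.

End BaseRing.
(** In degree 0 the augmentation of a resolution of the regular module represents the identity of L,
    and a class there vanishes only if its cocycle does. *)
Lemma ca0_eq0 (A : comPzRingType) (L : pzRingType) (rho : {rmorphism A -> L})
    (c : ring_center L) :
  noetherian A -> finitely_generated (regmod rho) -> ca 0 c -> center_val c = 0.
Proof.
move=> noethA fL hc.
have fM : finitely_generated (L^c)^o by apply: (fg_restr fL).
have [F hF] := free_resolution (fun U V f => fg_inj_restr (f := f) noethA fL) fM.
pose P := Build_projective_resolution
  (fun i => dual_basis1_projective (hF i)) (raug_surj F) (rexact0 F) (fun i => rexactS F (i := i)).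
pose f : linhom (P 0%N) (L^c)^o := raug F.
have hf : f \in @is_cocycle L _ P (L^c)^o 0.
  by apply/asboolP => x; apply/(rexact0 F); exists x.
have := hc _ _ fM fM P 0%N (leqnn _) (\pi_(Ext P (L^c)^o 0) (Cocycle hf)).
rewrite [_ *: _]Ext_scaleE => /Ext_eq0 /= f0.
have [x hx] := raug_surj F (1 : L).
have /homP /(_ x) := f0; rewrite /= /hom_scale_fun /= hx => h.
by rewrite -[LHS]mul1r; apply: h.
Qed.

Section BaseRingAlgebra.
Variable A : comPzRingType.
Local Notation idA := (idfun : {rmorphism A -> A}).

Lemma regmod_id_linear : linear (id : regmod idA -> A^o).
Proof. by move=> a x y; rewrite regmodE mulrC. Qed.

Lemma regmod_id_dual_basis t : dual_basis t (regmod idA).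
Proof.
exists 1%N, (fun=> t \*: mklin regmod_id_linear), (fun=> 1 : A) => x.
by rewrite big_ord1 !regmodE /= mul1r mulrC.
Qed.

Lemma regmod_id_fg : finitely_generated (regmod idA).
Proof. exact/dual_basis1_fg/regmod_id_dual_basis. Qed.

End BaseRingAlgebra.

(** * The endomorphism ring as a matrix ring up to a scalar *)

Section EndomorphismAlgebra.
Variables (A : comPzRingType) (M : lmodType A).

Definition homothety (a : A) : endo M := (a \*: idfun : {linear M -> M}).

Lemma homothety_zmod : zmod_morphism homothety.
Proof. by move=> a b; apply/homP => x; apply: scalerBl. Qed.

Lemma homothety_monoid : monoid_morphism homothety.
Proof.
split=> [|a b]; apply/homP => x; first exact: scale1r.
by rewrite /= scalerA.
Qed.

HB.instance Definition _ :=
  GRing.isZmodMorphism.Build A (endo M) homothety homothety_zmod.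
HB.instance Definition _ :=
  GRing.isMonoidMorphism.Build A (endo M) homothety homothety_monoid.

Lemma homothetyC a (f : endo M) : homothety a * f = f * homothety a.
Proof. by apply/homP => x; rewrite /= linearZ_LR. Qed.

Lemma endo_sumE (I : finType) (F : I -> endo M) x :
  (\sum_i F i) x = \sum_i F i x.
Proof. by elim/big_rec2: _ => // i y f _ <-. Qed.

Lemma endo_fg : noetherian A -> finitely_generated M ->
  finitely_generated (regmod homothety).
Proof.
move=> noethA fM; have [k [e he]] := fM.
have lev : linear (fun f : regmod homothety =>
    [ffun i => (f : endo M) (e i)] : {ffun 'I_k -> M}).
  move=> a f g; apply/ffunP => i;
    rewrite !ffunE -(linearZ_LR (f : {linear M -> M})).
  by [].
apply: (fg_inj noethA (f := mklin lev)); last exact: ffun_fg.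
move=> f g /ffunP fg; apply/homP => x; have [c ->] := he x.
rewrite !linear_sum; apply: eq_bigr => i _.
rewrite (linearZ_LR (f : {linear M -> M})) (linearZ_LR (g : {linear M -> M}));
  congr (_ *: _).
by have := fg i; rewrite !ffunE.
Qed.

Lemma rank_one_linear (m : M) (f : {linear M -> A^o}) :
  linear (fun x => (f x : A) *: m).
Proof. by move=> a x y; rewrite linearP scalerDl /= scalerA. Qed.

Definition rank_one m f : endo M := mklin (rank_one_linear m f).

Variables (d : A) (r : nat) (m : 'I_r -> M) (f : 'I_r -> {linear M -> A^o}).
Hypothesis mf : approx_basis d m f.

(** The maps m_i f_j serve as matrix units; expanding the argument and the value of [phi] costs one
    [d] each. *)
Lemma endo_dual_basis : dual_basis (d * d) (regmod homothety).
Proof.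
have lh (ij : 'I_r * 'I_r) :
    linear (fun phi : regmod homothety => f ij.1 ((phi : endo M) (m ij.2)) : A^o).
  move=> a phi psi; rewrite -linearP -(linearZ_LR (phi : {linear M -> M})).
  by [].
apply: (dual_basis_fin (h := fun ij => mklin (lh ij))
  (y := fun ij => rank_one (m ij.1) (f ij.2))) => phi.
apply/homP => x; rewrite -[LHS]/((phi : endo M) ((d * d) *: x)).
rewrite -(pair_bigA _ (fun i j => (f i ((phi : endo M) (m j)) : A) *:
  (rank_one (m i) (f j) : regmod homothety))) /=.
rewrite exchange_big /= endo_sumE.
rewrite -scalerA (proj2 mf) linear_sum; apply: eq_bigr => j _.
rewrite endo_sumE (linearZ_LR (phi : {linear M -> M})) (linearZ_LR (f j)).
rewrite -[(d *: (f j x : A^o) : A)]mulrC -scalerA (proj2 mf) scaler_sumr.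
apply: eq_bigr => i _.
rewrite regmodE /= !scalerA (linearZ_LR (f j)) [f j x * _]mulrC; exact: erefl.
Qed.

(** The sum of E_{i,i0} (x) E_{i0,i} is the separability element of a matrix ring. The coefficients
    f_j(s m_i) are the matrix entries of [s], the same here and in [endo_separable_p]. *)
Lemma endo_separable_q i0 (s : endo M) i :
  homothety d * (s * rank_one (m i) (f i0)) =
  \sum_j homothety (f j (s (m i))) * rank_one (m j) (f i0).
Proof.
apply/homP => x; rewrite endo_sumE /= linearZ_LR scalerA mulrC -scalerA.
rewrite (proj2 mf) scaler_sumr; apply: eq_bigr => j _.
by rewrite /= !scalerA mulrC.
Qed.

Lemma endo_separable_p i0 (s : endo M) j :
  homothety d * (rank_one (m i0) (f j) * s) =
  \sum_i homothety (f j (s (m i))) * rank_one (m i0) (f i).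
Proof.
apply/homP => x; rewrite endo_sumE /= scalerA.
have -> : d * (f j (s x) : A) = f j (s (d *: x)).
  by rewrite (linearZ_LR s) (linearZ_LR (f j)).
rewrite (proj2 mf) (linear_sum s) (linear_sum (f j)) scaler_suml;
  apply: eq_bigr => i _.
by rewrite /= (linearZ_LR s) (linearZ_LR (f j)) scalerA mulrC.
Qed.

Lemma endo_separable_qp i0 :
  \sum_i rank_one (m i) (f i0) * rank_one (m i0) (f i) = homothety (d * d).
Proof.
apply/homP => x; rewrite endo_sumE /= -scalerA (proj2 mf).
apply: eq_bigr => i _.
rewrite /= (linearZ_LR (f i0)) (proj1 mf) eqxx mulr1n (linearZ_LR (f i)).
by congr (_ *: _); apply: mulrC.
Qed.

End EndomorphismAlgebra.

Section AlgebraBasis.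
Variables (A : comPzRingType) (L : algType A).
Local Notation rho := (GRing.in_alg L : {rmorphism A -> L}).

Lemma in_algC a x : rho a * x = x * rho a.
Proof. by rewrite /= mulr_algl mulr_algr. Qed.

Lemma regmod_alg_linear : linear (id : L -> regmod rho).
Proof. by move=> a x y; rewrite regmodE /= mulr_algr. Qed.

Lemma alg_regmod_linear : linear (id : regmod rho -> L).
Proof. by move=> a x y; rewrite regmodE /= mulr_algr. Qed.

End AlgebraBasis.

(** * The two halves of the theorem *)

Lemma nonzerodivisorX (A : comPzRingType) (d : A) k :
  nonzerodivisor d -> nonzerodivisor (d ^+ k).
Proof.
move=> hd; elim: k => [|k IHk]; first exact: nonzerodivisor1.
by rewrite exprS; apply: nonzerodivisorM.
Qed.

Theorem corollary6p7 (A : comPzRingType) (n : nat) :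
  noetherian A ->
  (forall L : algType A,
     finitely_generated L -> positive_rank L ->
     (exists2 a : ring_center L, ca n a & nonzerodivisor a) ->
     reduced A /\
     exists2 a : ring_center A, ca n a & nonzerodivisor (center_val a)) /\
  ((exists2 a : ring_center A, ca n a & nonzerodivisor (center_val a)) ->
   forall M : lmodType A,
     finitely_generated M -> torsion_free M -> positive_rank M ->
     exists2 a : ring_center (endo M), ca n a & nonzerodivisor a).
Proof.
move=> noethA.
have idC (a x : A) : (idfun : {rmorphism A -> A}) a * x = x * a by apply: mulrC.
split=> [L fL [r r0 hr] [c hc c_nzd]|[a ha a_nzd] M fM tfM [r r0 hr]];
    pose i0 := Ordinal r0.
  have [d [m [f [d_nzd mf]]]] := rank_approx_basis fL hr.
  pose rho : {rmorphism A -> L} := GRing.in_alg L.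
  have rhoC := @in_algC A L : forall a x, rho a * x = x * rho a.
  pose v : {linear regmod rho -> L} := mklin (@alg_regmod_linear A L).
  pose w : {linear L -> regmod rho} := mklin (@regmod_alg_linear A L).
  have fR : finitely_generated (regmod rho).
    by apply: (fg_surj (f := w)) fL => x; exists x.
  have bL : dual_basis d (regmod rho).
    exists r, (fun i => f i \o v), (fun i => w (m i)) => x.
    rewrite -[x]/(w (v x)) -(linearZ_LR w) (proj2 mf) linear_sum.
    by apply: eq_bigr => i _; rewrite (linearZ_LR w).
  pose g : {linear regmod rho -> A^o} := f i0 \o v.
  have gm : g (w (m i0)) = d by rewrite /= (proj1 mf) eqxx.
  (* Positive rank provides the index [i0], and x m_{i0} = 0 forces x d = 0. *)
  have faith x : rho x = 0 -> x = 0.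
    move=> x0; apply: d_nzd; have : f i0 (x *: m i0) = 0.
      by rewrite -mulr_algl [_%:A]x0 mul0r raddf0.
    by rewrite linearZ_LR (proj1 mf) eqxx => h; rewrite mulrC.
  case: n hc => [|n] hc.
    (* For n = 0 the non-zerodivisor [c] is 0, which would make L the zero ring. *)
    have c0 := ca0_eq0 noethA fR hc.
    have : (1 : ring_center L) = 0 by apply: c_nzd; apply/val_inj;
      rewrite /= c0 mul0r.
    by move/(congr1 val)/eqP; rewrite oner_eq0.
  have redA := reduced_base noethA rhoC fR bL gm d_nzd hc c_nzd.
  have cC x : center_val c * x = x * center_val c by apply/(centralP _ (valP c)).
  have c_nzd' x := @nonzerodivisor_center L c x c_nzd.
  split=> //.
  have [x x_nzd [z zC xz]] :=
    central_nonzerodivisor noethA rhoC fR cC c_nzd' redA faith.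
  have zc : z \in @central L by apply/centralP.
  (* A is trivially separable over itself, so both averaging constants are 1. *)
  pose b := 1 * 1 * (x * d ^+ (6 + n * 2)).
  have bc : b \in @central A by apply/centralP => y; apply: mulrC.
  exists (Center bc); last by rewrite /= /b !mul1r;
    apply: nonzerodivisorM => //; apply: nonzerodivisorX.
  apply: (@ca_transfer _ _ rho noethA rhoC fR d g (w (m i0)) bL gm A idfun idC
    (regmod_id_fg A) (regmod_id_dual_basis d) 1 (fun=> 1) (fun=> 1) (fun s _ _ => s)
    1 1 _ _ _ n c (Center zc) x (Center bc) xz hc erefl) => [s i|s i|].
  - by rewrite big_ord1 /= mul1r.
  - by rewrite big_ord1 /= !mul1r mulr1.
  - by rewrite big_ord1 /= mulr1.
have [d [m [f [d_nzd mf]]]] := rank_approx_basis fM hr.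
case: n ha => [|n] ha.
  (* For n = 0 the non-zerodivisor [a] is 0, so A and End(M) are zero and 1 will do. *)
  have a0 := ca0_eq0 noethA (regmod_id_fg A) ha.
  have A0 : (1 : A) = 0 by apply: a_nzd; rewrite a0 mul0r.
  have E0 : (1 : ring_center (endo M)) = 0.
    by apply/val_inj/homP => x; rewrite /= -[x]scale1r A0 !scale0r.
  exists 1 => [U V fU fV P i _ x|b _]; first by rewrite E0 scale0r.
  by rewrite -[b]mul1r E0 mul0r.
have aC : center_val a = center_val a * center_val (1 : ring_center A) by rewrite mulr1.
(* Averaging over the matrix units contributes [d] and [d * d], and t is [d * d] by
   [endo_dual_basis]. *)
pose b := d * (d * d) * (center_val a * (d * d) ^+ (6 + n * 2)).
have b_nzd : nonzerodivisor b.
  have dd := nonzerodivisorM d_nzd d_nzd.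
  exact: (nonzerodivisorM (nonzerodivisorM d_nzd dd)
    (nonzerodivisorM a_nzd (@nonzerodivisorX A (d * d) (6 + n * 2)%N dd))).
have bc : homothety M b \in @central (endo M) by apply/centralP => y;
  apply: homothetyC.
(* As M is torsion-free, multiplication by [b] is injective on M, so the homothety of [b] is a
   non-zerodivisor of the center. *)
exists (Center bc) => [|y /(congr1 val) /homP hy]; last first.
  by apply/val_inj/homP => x; apply: (tfM b b_nzd); apply: hy.
apply: (@ca_transfer _ A idfun noethA idC (regmod_id_fg A) (d * d)
  ((d * d) \*: mklin (@regmod_id_linear A)) (1 : A) (regmod_id_dual_basis (d * d)) _
  _ (homothety M) (@homothetyC _ M) (endo_fg noethA fM) (endo_dual_basis mf)
  r (fun i => rank_one (m i0) (f i)) (fun i => rank_one (m i) (f i0))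
  (fun s i j => f j (s (m i))) d (d * d) (endo_separable_q mf i0)
  (endo_separable_p mf i0) (endo_separable_qp mf i0) n a 1 _ (Center bc) aC ha erefl).
by rewrite /= /GRing.scale /= mulr1.
Qed.
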